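(* There exist a constant $c>0$ and an integer $N$ such that for every $n\ge N$ the following holds: if $G$ is an $n$-vertex outerplanar graph whose spread is maximum among all $n$-vertex outerplanar graphs, then $G$ is isomorphic to $K_1\vee F$, where $F$ is a linear forest on $n-1$ vertices with at least $cn$ edges.
   Context: For a graph $G$ with adjacency eigenvalues $\lambda_1\ge\cdots\ge\lambda_n$, the spread of $G$ is $S(G)=\lambda_1-\lambda_n$. A graph is outerplanar if it can be drawn in the plane without crossings so that all vertices lie on the unbounded face. $K_1\vee F$ denotes the join of a single vertex with $F$, i.e. a new vertex adjacent to all vertices of $F$. A linear forest is a disjoint union of paths. *)

(* Defs.v *)
From HB Require Import structures.
From mathcomp Require Import all_boot all_order all_algebra.
From mathcomp Require Import all_classical all_reals all_analysis.

Set Implicit Arguments.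
Unset Strict Implicit.
Unset Printing Implicit Defensive.

Import Order.TTheory GRing.Theory Num.Theory.
Import numFieldNormedType.Exports.

Local Open Scope classical_set_scope.
Local Open Scope ring_scope.

Record sgraph := SGraph {
  vertex :> finType;
  adj : rel vertex;
  adj_sym : symmetric adj;
  adj_irrefl : irreflexive adj }.

Definition edges (G : sgraph) : {set {set G}} :=
  [set [set u.1; u.2]%SET | u in [pred u : G * G | adj u.1 u.2]]%SET.

Definition isomorphic (G H : sgraph) : Prop :=
  exists2 f : G -> H, bijective f & forall x y, adj (f x) (f y) = adj x y.

Definition K1_adj : rel unit := fun _ _ => false.

Fact K1_adj_sym : symmetric K1_adj. Proof. by []. Qed.

Fact K1_adj_irrefl : irreflexive K1_adj. Proof. by []. Qed.

Definition K1 : sgraph := SGraph K1_adj_sym K1_adj_irrefl.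

Section Join.
Variables G H : sgraph.

Definition join_adj : rel (G + H) := fun u v =>
  match u, v with
  | inl x, inl y => adj x y
  | inr x, inr y => adj x y
  | _, _ => true
  end.

Fact join_adj_sym : symmetric join_adj.
Proof. by move=> [x|x] [y|y] //=; exact: adj_sym. Qed.

Fact join_adj_irrefl : irreflexive join_adj.
Proof. by move=> [x|x] /=; exact: adj_irrefl. Qed.

Definition join : sgraph := SGraph join_adj_sym join_adj_irrefl.
End Join.

Section DisjointUnion.
Variables (I : finType) (G : I -> sgraph).

Definition union_adj : rel {i : I & G i} := fun u v =>
  (tag u == tag v) && adj (tagged u) (tagged_as u v).

Fact union_adj_sym : symmetric union_adj.
Proof.
move=> [i x] [j y]; rewrite /union_adj /= eq_sym.
case: (eqVneq j i) => //= eji; subst j.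
by rewrite !tagged_asE adj_sym.
Qed.

Fact union_adj_irrefl : irreflexive union_adj.
Proof. by move=> [i x]; rewrite /union_adj /= eqxx tagged_asE adj_irrefl. Qed.

Definition disjoint_union : sgraph := SGraph union_adj_sym union_adj_irrefl.
End DisjointUnion.

Section PathGraph.
Variable k : nat.

Definition path_adj : rel 'I_k := fun i j =>
  (i.+1 == j :> nat) || (j.+1 == i :> nat).

Fact path_adj_sym : symmetric path_adj.
Proof. by move=> i j; rewrite /path_adj orbC. Qed.

Fact path_adj_irrefl : irreflexive path_adj.
Proof. by move=> i; rewrite /path_adj orbb gtn_eqF. Qed.

Definition path_graph : sgraph := SGraph path_adj_sym path_adj_irrefl.
End PathGraph.

Definition linear_forest (F : sgraph) : Prop :=
  exists m (k : 'I_m -> nat),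
    isomorphic F (disjoint_union (fun i => path_graph (k i).+1)).

Section Spread.
Variables (R : realType) (G : sgraph).

Definition adjacency_matrix : 'M[R]_#|G| :=
  \matrix_(i, j) (adj (enum_val i) (enum_val j))%:R.

Definition spectrum : set R := [set a | eigenvalue adjacency_matrix a].

(* The spectrum is finite, and nonempty as soon as G has a vertex, so that sup *)
(* and inf are here the largest and the smallest eigenvalue.                   *)
Definition spread : R := sup spectrum - inf spectrum.
End Spread.

Section Outerplanar.
Variables (R : realType) (G : sgraph).

(* The edge e is drawn as the simple arc t |-> gamma e t, t in [0, 1]; the     *)
(* values of gamma outside of edges and of [0, 1] are irrelevant.              *)
Record crossing_free_drawing (p : G -> R * R) (gamma : {set G} -> R -> R * R) :
    Prop := CrossingFreeDrawing {
  vertices_inj : injective p;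
  arc_continuous : forall e, e \in edges G ->
    {within `[0, 1], continuous (gamma e)};
  arc_inj : forall e, e \in edges G ->
    {in `[0, 1] &, injective (gamma e)};
  arc_ends : forall e, e \in edges G ->
    gamma e @` [set 0; 1] = p @` [set` e];
  arc_avoids_vertices : forall e x t, e \in edges G -> t \in `]0, 1[ ->
    gamma e t <> p x;
  arcs_disjoint : forall e e' s t, e \in edges G -> e' \in edges G -> e != e' ->
    s \in `]0, 1[ -> t \in `]0, 1[ -> gamma e s <> gamma e' t }.

Definition drawn_points (p : G -> R * R) (gamma : {set G} -> R -> R * R) :
    set (R * R) :=
  range p `|` \bigcup_(e in [set` edges G]) (gamma e @` `[0, 1]).

(* For D compact, the complement of D has exactly one unbounded component.     *)
Definition unbounded_face (D : set (R * R)) : set (R * R) :=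
  [set q | (~` D) q /\ ~ bounded_set (connected_component (~` D) q)].

(* A vertex lies on a face when it belongs to the boundary of that face, or,   *)
(* equivalently since faces contain no vertex, to its closure.                 *)
Definition outerplanar : Prop :=
  exists p gamma, crossing_free_drawing p gamma /\
    forall x, closure (unbounded_face (drawn_points p gamma)) (p x).
End Outerplanar.

(* Main.v *)
Require Import Defs.
From mathcomp Require Import all_boot all_order all_algebra.
From mathcomp Require Import all_classical all_reals all_analysis.
From mathcomp Require Import ring lra zify.
From Stdlib Require Import Btauto.

Set Implicit Arguments.
Unset Strict Implicit.
Unset Printing Implicit Defensive.

Import Order.TTheory GRing.Theory Num.Theory.
Import numFieldNormedType.Exports.

Local Open Scope classical_set_scope.
Local Open Scope ring_scope.

(* A drawing is replaced by fine polygonal chains. For two disjoint chains, the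
   windings (modulo 2) of each around the end points of the other sum to a quantity
   that depends only on the four end points, because the direction from one chain to
   the other is a map on a rectangle. A point near the unbounded face has winding 0
   with respect to all closed chains. Summing over the independent pairs of edges of
   K_4 or of K_{2,3} gives 0 = 1; so an outerplanar graph contains no subdivision of
   these graphs. Consequently its subgraphs have a vertex of degree at most 2, two
   vertices have at most two common neighbours, and the neighbourhood of a vertex
   induces a linear forest.

   Let n = s^2 + 1. The spread of an extremal graph exceeds 2 s, and both extreme
   eigenvalues k satisfy k^3 <= k d + 8 n, where d is the degree of a vertex at which
   the eigenvector is maximal in absolute value; hence |k| = s + O(1), d = n - O(s), and
   both eigenvectors have the same maximal vertex w. The eigenvector entries at the
   nonneighbours of w are O(1/n), so joining w to everything, and keeping only the edges
   inside its neighbourhood, would increase the spread if w had a nonneighbour. Finally,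
   if w is adjacent to all other vertices and the remaining linear forest has total
   degree D, then k^3 = (n-1) k + D + O(D/s), which bounds the spread by
   2 s + O(D/s^3); comparison with K_1 joined to n/3 disjoint edges forces D >= s^2/16. *)

(** * Winding numbers modulo 2 of polygonal chains *)

Section Winding.
Variable R : realType.
Implicit Types (p q x y c : R * R) (s t : seq (R * R)) (r : R).

(** The positive first axis is included so that exactly one of two opposite nonzero vectors is [up];
    the final parity contradictions rest on this. *)
Definition up p : bool := (0 < p.2) || ((p.2 == 0) && (0 < p.1)).

(* Up to sign, the crossing of the negative first axis on the way from [p] to [q]. *)
Definition flip p q : bool := (up p (+) up q) && (p.1 < 0).

(** Parity of the crossings of the chain with the ray leaving [p] in the negative first direction;
    for fine closed chains away from [p] this is the winding number modulo 2. *)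
Fixpoint wind p x s : bool :=
  if s is y :: s' then flip (x - p) (y - p) (+) wind p y s' else false.

Definition chain r x s := path (fun a b => `|a - b| < r) x s.

Lemma chain_le r r' x s : r <= r' -> chain r x s -> chain r' x s.
Proof. by move=> rr'; apply: sub_path => a b /lt_le_trans; exact. Qed.

Lemma up_opp p : p != 0 -> up (- p) = ~~ up p.
Proof.
case: p => a b; rewrite /up /= oppr_gt0 oppr_eq0 oppr_gt0.
case: (ltgtP b 0) => //= ->; case: (ltgtP a 0) => //= ->.
by rewrite eqxx.
Qed.

Lemma up_sub x y : x != y -> up (x - y) = ~~ up (y - x).
Proof. by move=> xy; rewrite -opprB up_opp // subr_eq0 eq_sym. Qed.

(** These four half planes suffice because balls of the maximum norm are squares: a ball missing the
    origin lies in one of them. *)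
Definition halfplane (P : R * R -> Prop) :=
  [\/ forall p, P p -> 0 < p.1, forall p, P p -> p.1 < 0,
      forall p, P p -> 0 < p.2 | forall p, P p -> p.2 < 0].

(** On the left half plane every change of [up] is a crossing, so [up] itself is a potential; on the
    other three no crossing occurs. *)
Lemma flip_halfplane (P : R * R -> Prop) : halfplane P ->
  exists g, forall p q, P p -> P q -> flip p q = g p (+) g q.
Proof.
case=> H.
- exists xpred0 => p q /H Pp _; rewrite /flip [p.1 < 0]ltNge (ltW Pp) andbF //.
- by exists up => p q /H Pp _; rewrite /flip Pp andbT.
- by exists xpred0 => p q /H Pp /H Pq; rewrite /flip /up Pp Pq.
- exists xpred0 => p q /H Pp /H Pq.
  by rewrite /flip /up (lt_eqF Pp) (lt_eqF Pq) !ltNge (ltW Pp) (ltW Pq).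
Qed.

Lemma prod_normE p : `|p| = Num.max `|p.1| `|p.2|.
Proof. by []. Qed.

Lemma ball_halfplane c r : r <= `|c| -> halfplane (fun p => `|p - c| < r).
Proof.
move=> rc; have coord p : `|p - c| < r -> `|p.1 - c.1| < r /\ `|p.2 - c.2| < r.
  by rewrite prod_normE gt_max => /andP.
move: rc; rewrite prod_normE le_max => /orP[] rc.
- have [c0|c0] := leP 0 c.1.
  + apply: Or41 => p /coord[+ _]; rewrite ltr_norml => /andP[].
    by move: rc; rewrite ger0_norm //; lra.
  + apply: Or42 => p /coord[+ _]; rewrite ltr_norml => /andP[].
    by move: rc; rewrite ltr0_norm //; lra.
- have [c0|c0] := leP 0 c.2.
  + apply: Or43 => p /coord[_ +]; rewrite ltr_norml => /andP[].
    by move: rc; rewrite ger0_norm //; lra.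
  + apply: Or44 => p /coord[_ +]; rewrite ltr_norml => /andP[].
    by move: rc; rewrite ltr0_norm //; lra.
Qed.

Lemma wind_halfplane p (A : set (R * R)) : halfplane (fun q => A (q + p)) ->
  exists g : R * R -> bool, forall x s, (forall a, a \in x :: s -> A a) ->
    wind p x s = g x (+) g (last x s).
Proof.
move=> /flip_halfplane[g gP]; exists (fun q => g (q - p)) => x s.
elim: s x => [|y s IH] x sA /=; first by rewrite addbb.
rewrite IH => [|a al]; last by apply: sA; rewrite inE al orbT.
rewrite gP ?subrK; try by apply: sA; rewrite !inE eqxx ?orbT.
by case: (g (x - p)); case: (g (y - p)); case: (g (last y s - p)).
Qed.

(** For each step from [x] to [a], the four differences with [y] and [y'] lie in a ball missing the
    origin, where flips around a quadrilateral cancel. Along the chain the inner flips telescope. *)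
Lemma wind_strip r x s y y' : (forall a, a \in x :: s -> r *+ 2 <= `|a - y|) ->
  chain r x s -> `|y - y'| < r ->
  wind y x s (+) wind y' x s =
  flip (x - y) (x - y') (+) flip (last x s - y) (last x s - y').
Proof.
move=> far + yy'; elim: s x far => [|a s IH] x far /=.
  by rewrite addbb.
case/andP=> xa cs; have r0 : 0 < r by exact: le_lt_trans yy'.
have h : r *+ 2 <= `|x - y| by apply: far; rewrite mem_head.
have [g gP] := flip_halfplane (ball_halfplane h).
have n1 : `|x - y - (x - y)| < r *+ 2 by rewrite subrr normr0 mulrn_wgt0.
have n2 : `|a - y - (x - y)| < r *+ 2.
  by rewrite opprB addrA subrK distrC (lt_trans xa) // mulr2n ltrDl.
have n3 : `|x - y' - (x - y)| < r *+ 2.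
  rewrite opprB addrC addrA subrK.
  by rewrite (lt_trans yy') // mulr2n ltrDl.
have n4 : `|a - y' - (x - y)| < r *+ 2.
  have -> : a - y' - (x - y) = (y - y') - (x - a).
    by case: (x) (a) (y) (y') => [? ?] [? ?] [? ?] [? ?]; congr pair => /=; ring.
  by rewrite (le_lt_trans (ler_normB _ _)) // mulr2n ltrD.
rewrite (gP _ _ n1 n2) (gP _ _ n3 n4) (gP _ _ n1 n3).
have := IH a _ cs; rewrite (gP _ _ n2 n4) => {}IH.
have {}IH := IH (fun b bs => far b (mem_behead (s := [:: x, a & s]) bs)).
by move: IH; case: (wind y a s); case: (wind y' a s); case: (flip _ _);
  case: (g (x - y)); case: (g (x - y')); case: (g (a - y)); case: (g (a - y')).
Qed.

(** A step crosses either half of the first axis, and negation exchanges the two halves; hence the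
    two flips together count every change of [up]. *)
Lemma flip_opp r x y y' : r <= `|x - y| -> `|y - y'| < r ->
  flip (x - y) (x - y') = flip (y - x) (y' - x) (+) (up (x - y) (+) up (x - y')).
Proof.
move=> far yy'; have r0 : 0 < r by exact: le_lt_trans yy'.
have nz : x - y != 0 by rewrite -normr_gt0 (lt_le_trans r0).
have nz' : x - y' != 0.
  apply: contraTneq yy' => /eqP; rewrite subr_eq0 => /eqP <-.
  by rewrite -leNgt distrC.
rewrite -(opprB x y) -(opprB x y') /flip !up_opp // /=.
have := ball_halfplane far.
have m1 : `|x - y - (x - y)| < r by rewrite subrr normr0.
have m2 : `|x - y' - (x - y)| < r by rewrite opprB addrC addrA subrK.
case=> /[dup] /(_ _ m1) h1 /(_ _ m2) h2.
- rewrite /= in h1 h2; rewrite !oppr_lt0 h1 [_ < 0]ltNge (ltW h1) /= andbF andbT.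
  by case: (up _); case: (up _).
- rewrite /= in h1 h2; rewrite !oppr_lt0 h1 [0 < _]ltNge (ltW h1) /= andbF andbT.
  by case: (up _); case: (up _).
- by rewrite /up h1 h2.
- by rewrite /up (lt_eqF h1) (lt_eqF h2) !ltNge (ltW h1) (ltW h2).
Qed.

(** Induction on [t]: a step from [y] to [b] changes the winding of the first chain by flips at its
    two ends ([wind_strip]), and [flip_opp] converts these into steps of the windings around [x] and
    [last x s], up to [up] terms that telescope. *)
Lemma wind_cross r x s y t :
    (forall a b, a \in x :: s -> b \in y :: t -> r *+ 2 <= `|a - b|) ->
    chain r x s -> chain r y t ->
  wind y x s (+) wind (last y t) x s (+) wind x y t (+) wind (last x s) y t =
  up (x - y) (+) up (x - last y t) (+) up (last x s - y)
    (+) up (last x s - last y t).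
Proof.
move=> + cs; elim: t y => [|b t IH] y far /=.
  by move=> _; rewrite addbb !addbF /=; do 2!case: (up _).
case/andP=> yb ct.
have {}IH := IH b (fun a c al cl => far a c al (mem_behead (s := [:: y, b & t]) cl)) ct.
have r0 : 0 < r by exact: le_lt_trans yb.
have le2 : r <= r *+ 2 by rewrite mulr2n lerDl ltW.
have st : wind y x s (+) wind b x s =
  flip (x - y) (x - b) (+) flip (last x s - y) (last x s - b).
  by apply: (wind_strip (r := r)) => // a al; apply: far => //; rewrite mem_head.
have fo a : a \in x :: s ->
  flip (a - y) (a - b) = flip (y - a) (b - a) (+) (up (a - y) (+) up (a - b)).
  move=> al; apply: (flip_opp (r := r)) => //.
  by rewrite (le_trans le2) // far ?mem_head.
rewrite !fo ?mem_head ?mem_last // in st.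
rewrite (canRL (addbK _) st) {st}.
have -> (a1 a2 a3 a4 a5 a6 a7 : bool) : a1 (+) a2 (+) a3 (+) (a4 (+) a5) (+)
  (a6 (+) a7) = (a2 (+) a3 (+) a5 (+) a7) (+) (a1 (+) a4 (+) a6).
  by case: a1; case: a2; case: a3; case: a4; case: a5; case: a6; case: a7.
rewrite IH.
case: (flip _ _); case: (flip _ _);
  case: (up _); case: (up _); case: (up _); case: (up _); case: (up _);
  by case: (up _).
Qed.

End Winding.

(** * Connectedness, compactness and potentials *)

Section Topology.
Variable R : realType.
Implicit Types (a b p q x y : R * R) (A B : set (R * R)).

(** The balls on which [P] is constant make both [P] and its complement relatively open in [A]. *)
Lemma connected_local A (P : R * R -> Prop) a : connected A -> A a -> P a ->
  (forall x, A x -> exists2 r, 0 < r &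
     forall y, A y -> `|x - y| < r -> (P x <-> P y)) ->
  forall x, A x -> P x.
Proof.
move=> cA Aa Pa loc x Ax.
pose U (Q : R * R -> Prop) := \bigcup_(xr in [set xr : (R * R) * R |
  [/\ A xr.1, Q xr.1 & forall y, A y -> `|xr.1 - y| < xr.2 -> (P xr.1 <-> P y)]])
  ball xr.1 xr.2.
have oU Q : open (U Q) by apply: bigcup_open => i _; exact: ball_open.
suff /seteqP[_ /(_ _ Ax)[]] : A `&` P = A by [].
apply: cA; first by exists a.
- exists (U P) => //; apply/seteqP; split=> y [Ay Py]; split=> //.
    have [r r0 rP] := loc _ Ay; exists (y, r); first by split.
    exact: ballxx.
  by case: Py => -[z r] /= [Az Pz +]; rewrite -ball_normE => /(_ _ Ay) H /H /proj1; apply.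
- exists (~` U (~` P)); first exact: open_closedC.
  apply/seteqP; split=> y [Ay Py]; split=> //.
    case=> -[z r] /= [Az nPz +].
    by rewrite -ball_normE => /(_ _ Ay) H /H /proj2 /(_ Py).
  apply: contrapT => nPy; apply: Py; have [r r0 rP] := loc _ Ay.
  by exists (y, r); [split|exact: ballxx].
Qed.

(** Being reachable by an [e]-chain is a locally constant property. *)
Lemma connected_chain A a b e : connected A -> A a -> A b -> 0 < e ->
  exists s, [/\ chain e a s, last a s = b & forall c, c \in a :: s -> A c].
Proof.
move=> cA Aa + e0; move: b; apply: (connected_local cA Aa).
  by exists [::]; split=> // c; rewrite inE => /eqP ->.
have step x y : A y -> `|x - y| < e ->
    (exists s, [/\ chain e a s, last a s = x & forall c, c \in a :: s -> A c]) ->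
    exists s, [/\ chain e a s, last a s = y & forall c, c \in a :: s -> A c].
  move=> Ay xy [s [cs ls sA]]; exists (rcons s y); split.
  - by rewrite /chain rcons_path -/(chain e a s) cs ls.
  - by rewrite last_rcons.
  - by move=> c; rewrite -rcons_cons mem_rcons inE => /predU1P[->//|/sA].
move=> x Ax; exists e => // y Ay xy; split; first exact: step.
by apply: step => //; rewrite distrC.
Qed.

Lemma compact_distance A B : compact A -> compact B -> A `&` B = set0 ->
  exists2 e, 0 < e & forall a b, A a -> B b -> e <= `|a - b|.
Proof.
move=> cA cB AB0; have [[[a b] ABab]|/set0P/negP/negPn/eqP AB] :=
  pselect (A `*` B !=set0); last first.
  exists 1 => // a b Aa Bb; have : (A `*` B) (a, b) by split.
  by rewrite AB.
have [|[c d]] := @compact_EVT_min _ R (fun u => `|u.1 - u.2|) _ (ex_intro _ _ ABab)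
  (compact_setX cA cB).
  apply: continuous_subspaceT => u.
  apply: (@continuous_comp _ _ _ (fun u : (R * R) * (R * R) => u.1 - u.2) (fun v => `|v|));
    last exact: norm_continuous.
  by apply: continuousB; [exact: cvg_fst|exact: cvg_snd].
rewrite inE => -[/= Ac Bd] min; exists `|c - d|.
  rewrite normr_gt0 subr_eq0; apply/eqP => cd.
  by have : (A `&` B) c by [split; rewrite // cd]; rewrite AB0.
by move=> a' b' Aa Bb; apply: (min (a', b')); rewrite inE.
Qed.

(* In other words, sufficiently fine closed chains in [A] have winding 0 around [q]. *)
Definition potential A q := exists2 e : R, 0 < e & exists h : R * R -> bool,
  forall x s, chain e x s -> (forall a, a \in x :: s -> A a) ->
    wind q x s = h x (+) h (last x s).

Lemma potential_sub A B q : A `<=` B -> potential B q -> potential A q.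
Proof.
move=> AB [e e0 [h hP]]; exists e => //; exists h => x s cs sA.
by apply: hP => // a /sA /AB.
Qed.

(** By [wind_strip] the windings around [q] and [q'] differ by the values of [k] at the two ends,
    which can be added to a potential. *)
Lemma potential_step A q q' r : (forall a, A a -> r *+ 2 <= `|a - q|) ->
  `|q - q'| < r -> potential A q <-> potential A q'.
Proof.
move=> far qq'; have r0 : 0 < r by exact: le_lt_trans qq'.
pose k a := flip (a - q) (a - q').
have strip x s : chain r x s -> (forall a, a \in x :: s -> A a) ->
    wind q x s (+) wind q' x s = k x (+) k (last x s).
  by move=> cs sA; apply: (wind_strip (r := r)) => // a /sA /far.
split=> -[e e0 [h hP]]; exists (Num.min e r); rewrite ?lt_min ?e0 //;
  exists (fun x => h x (+) k x) => x s cs sA.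
all: have ce : chain e x s by apply: chain_le cs; rewrite ge_min lexx.
all: have cr : chain r x s by apply: chain_le cs; rewrite ge_min lexx orbT.
  by rewrite (canRL (addKb _) (strip _ _ cr sA)) hP // addbACA.
by rewrite (canRL (addbK _) (strip _ _ cr sA)) hP // addbC addbACA.
Qed.

(** Some coordinate of [q] exceeds in absolute value those of all points of [A], so that [A] seen
    from [q] lies in a half plane. *)
Lemma potential_far A : bounded_set A ->
  exists M : R, forall q, M < `|q| -> potential A q.
Proof.
case=> M0 [_ /(_ (M0 + 1))]; rewrite ltrDl ltr01 => /(_ isT) MP.
exists (M0 + 1) => q; set M := M0 + 1 in MP *.
suff : M < `|q| -> halfplane (fun v => A (v + q)).
  by move=> /[apply] /wind_halfplane[h hP]; exists 1 => //; exists h => x s _ /hP.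
have coord v : A (v + q) -> `|v.1 + q.1| <= M /\ `|v.2 + q.2| <= M.
  by move=> /MP /=; rewrite prod_normE ge_max => /andP[].
rewrite prod_normE lt_max => /orP[]; rewrite lter_normr => /orP[] Mq.
- by apply: Or42 => v /coord[+ _]; rewrite ler_norml => /andP[]; lra.
- by apply: Or41 => v /coord[+ _]; rewrite ler_norml => /andP[]; lra.
- by apply: Or44 => v /coord[_ +]; rewrite ler_norml => /andP[]; lra.
- by apply: Or43 => v /coord[_ +]; rewrite ler_norml => /andP[]; lra.
Qed.

(** The component of [q] contains points arbitrarily far away, where [potential_far] applies, and
    having a potential is locally constant off [A]. *)
Lemma potential_unbounded_face A q : compact A -> unbounded_face A q -> potential A q.
Proof.
move=> cA [nAq ubd]; have [M MP] := potential_far (compact_bounded cA).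
have [q' [Cq' Mq']] : exists q', connected_component (~` A) q q' /\ M < `|q'|.
  apply: contrapT => H; apply: ubd; exists M; split; first exact: num_real.
  move=> N MN x Cx /=; rewrite (le_trans _ (ltW MN)) // leNgt; apply/negP => Mx.
  by apply: H; exists x.
have := connected_local (P := potential A) 
  (@connected.component_connected _ (~` A) q) Cq' (MP _ Mq').
apply; last exact: connected_component_refl.
move=> x Cx.
have nAx := connected_component_sub Cx.
have : A `&` [set x] = set0 by apply/seteqP; split=> // y [/[swap] /= ->].
case/(compact_distance cA (@compact_set1 _ x)) => e e0 eP.
exists (e / 2); first by rewrite divr_gt0.
move=> y _; apply: potential_step => a Aa.
by rewrite mulr2n -splitr eP.
Qed.

End Topology.

(** * From a drawing to chains *)

Lemma edgesP (G : sgraph) (e : {set G}) :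
  reflect (exists u v : G, adj u v /\ e = [set u; v]%SET) (e \in edges G).
Proof.
apply: (iffP imsetP) => [[[u v] /= uv ->]|[u [v [uv ->]]]]; first by exists u, v.
by exists (u, v).
Qed.

(** The walk may repeat vertices; it is recorded only through a set [S] containing it, so that
    disjointness of links is disjointness of sets. *)
Definition linked (G : sgraph) (S : {set G}) (u v : G) :=
  exists w, [/\ path (@adj G) u w, last u w = v & {subset u :: w <= S}].

Lemma linked_mem (G : sgraph) (S : {set G}) u v : linked S u v -> u \in S /\ v \in S.
Proof. by case=> w [_ <- sub]; rewrite !sub ?mem_head ?mem_last. Qed.

Section Drawing.
Variables (R : realType) (G : sgraph) (p : G -> R * R) (gamma : {set G} -> R -> R * R).
Hypothesis drawing : crossing_free_drawing p gamma.
Implicit Types (S T e : {set G}) (u v z : G).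

Definition arc e := gamma e @` `[0, 1].

(** The drawing of the subgraph induced by [S]. *)
Definition carrier S : set (R * R) :=
  p @` [set` S] `|` \bigcup_(e in [set e | e \in edges G /\ e \subset S]) arc e.

Lemma arc_point e (t : R) : e \in edges G -> t \in `[0, 1] ->
  (t \in `]0, 1[) \/ exists2 u, u \in e & gamma e t = p u.
Proof.
move=> eG; rewrite !in_itv /= => /andP[t0 t1].
have ends : forall t, t = 0 \/ t = 1 -> exists2 u, u \in e & gamma e t = p u.
  move=> t' t'01; have : (gamma e @` [set 0; 1]) (gamma e t') by exists t'.
  by rewrite (arc_ends drawing eG) => -[u /= ue <-]; exists u.
case: (ltgtP 0 t) t0 => // [t0|t0] _; last by right; apply: ends; left.
by case: (ltgtP t 1) t1 => // t1 _; [left|right; apply: ends; right].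
Qed.

Lemma arc_compact e : e \in edges G -> compact (arc e).
Proof.
move=> eG; apply: continuous_compact; first exact: (arc_continuous drawing).
exact: segment_compact.
Qed.

Lemma arc_connected e : e \in edges G -> connected (arc e).
Proof.
move=> eG; apply: connected_continuous_connected; last exact: (arc_continuous drawing).
exact: segment_connected.
Qed.

Lemma arc_vertex e u : e \in edges G -> u \in e -> arc e (p u).
Proof.
move=> eG ue; have : (p @` [set` e]) (p u) by exists u.
rewrite -(arc_ends drawing eG) => -[t t01 <-]; exists t => //=.
by rewrite in_itv /=; case: t01 => ->; rewrite lexx ler01.
Qed.

Lemma carrier_compact S : compact (carrier S).
Proof.
apply: compactU; first exact/finite_compact/finite_image/finite_finset.
rewrite (_ : [set _ | _] = [set e | (e \in index_enum {set G}) &&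
  ((e \in edges G) && (e \subset S))]).
  rewrite bigcup_seq_cond; apply: bigsetU_compact => e /andP[eG _].
  exact: arc_compact.
by apply/seteqP; split=> e /=; [case=> -> ->; rewrite mem_index_enum|case/and3P].
Qed.

(** An arc passes through no vertex but its ends, and distinct arcs meet only at such ends. *)
Lemma carrier_disjoint S T : [disjoint S & T]%B -> carrier S `&` carrier T = set0.
Proof.
have vertex_arc u e t : e \in edges G -> t \in `[0, 1] -> gamma e t = p u -> u \in e.
  move=> eG t01; case: (arc_point eG t01) => [t01'|[v ve ->]].
    by move/(arc_avoids_vertices drawing eG t01').
  by move/(vertices_inj drawing) <-.
move=> /pred0P dST; apply/seteqP; split=> // a [].
have nST x : x \in S -> x \in T -> False by move=> xS xT; have := dST x; rewrite /= xS xT.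
case=> [[u /= uS <-]|[e /= [eG /fintype.subsetP eS] [t t01 <-]]].
- case=> [[v /= vT /(vertices_inj drawing) vu]|[e /= [eG /fintype.subsetP eT] [t t01]]].
    by apply: (nST u); rewrite // -vu.
  by move/(vertex_arc _ _ _ eG t01) => /eT; exact: nST.
- case=> [[v /= vT]|[e' /= [e'G /fintype.subsetP e'T] [s s01]]].
    by move/esym/(vertex_arc _ _ _ eG t01) => /eS /nST; apply.
  case: (arc_point eG t01) => [t01'|[v ve ->]]; last first.
    by move/(vertex_arc _ _ _ e'G s01) => /e'T; apply: nST; exact: eS.
  case: (arc_point e'G s01) => [s01'|[v ve ->]]; last first.
    by move/esym/(vertex_arc _ _ _ eG t01) => /eS /nST; apply; exact: e'T.
  apply: (arcs_disjoint drawing) => //; apply/eqP => ee'.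
  move/edgesP: (eG) => [u [v [_ euv]]].
  by apply: (nST u); [apply: eS|apply: e'T; rewrite ee']; rewrite euv set21.
Qed.

Lemma carrier_drawn S : carrier S `<=` drawn_points p gamma.
Proof.
move=> a [[u _ <-]|[e /= [eG _] ea]]; first by left; exists u.
by right; exists e.
Qed.

Lemma carrier_sub S T : S \subset T -> carrier S `<=` carrier T.
Proof.
move=> ST a [[u /= uS <-]|[e /= [eG eS] ea]].
  by left; exists u => //=; exact: (fintype.subsetP ST u uS).
by right; exists e => //=; split=> //; exact: (fintype.subset_trans eS).
Qed.

Lemma drawn_pointsE : drawn_points p gamma = carrier [set: G]%SET.
Proof.
apply/seteqP; split; last exact: carrier_drawn.
move=> a [[u _ <-]|[e /= eG ea]]; first by left; exists u => //=; rewrite inE.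
by right; exists e => //=; split; rewrite // subsetT.
Qed.

(** There are finitely many pairs of sets, so one [r] serves all; the factor 2 is the clearance
    required by [wind_strip]. *)
Lemma carrier_distance : exists2 r : R, 0 < r & forall S T, [disjoint S & T]%B ->
  forall a b, carrier S a -> carrier T b -> r *+ 2 <= `|a - b|.
Proof.
have far (ST : {set G} * {set G}) : exists r : R, 0 < r /\
    ([disjoint ST.1 & ST.2]%B ->
     forall a b, carrier ST.1 a -> carrier ST.2 b -> r <= `|a - b|).
  have [dST|_] := boolP [disjoint ST.1 & ST.2]%B; last by exists 1.
  have [r r0 rP] := compact_distance (@carrier_compact ST.1) (@carrier_compact ST.2)
    (carrier_disjoint dST).
  by exists r.
have [f fP] := choice far.
pose m := \big[Num.min/1]_ST f ST.
have m0 : 0 < m.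
  rewrite /m; elim/big_ind: _ => // [x y x0 y0|ST _]; first by rewrite lt_min x0.
  by case: (fP ST).
exists (m / 2); first by rewrite divr_gt0.
move=> S T dST a b Sa Tb; rewrite mulr2n -splitr.
apply: le_trans ((fP (S, T)).2 dST a b Sa Tb).
by rewrite /m (bigD1 (S, T)) //= ge_min lexx.
Qed.

Lemma linked_chain S u v (r : R) : linked S u v -> 0 < r -> exists s,
  [/\ chain r (p u) s, last (p u) s = p v & forall a, a \in p u :: s -> carrier S a].
Proof.
case=> w [pw + sub] r0; elim: w u pw sub => [|x w IH] u /=.
  move=> _ sub <-; exists [::]; split=> // a; rewrite inE => /eqP ->.
  by left; exists u => //=; apply: sub; rewrite mem_head.
case/andP=> ux xw sub lw.
have [] := IH x xw _ lw; first by move=> y yw; apply: sub; rewrite inE yw orbT.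
move=> s [cs ls sA].
have eG : [set u; x]%SET \in edges G by apply/edgesP; exists u, x.
have [s' [cs' ls' sA']] := connected_chain (arc_connected eG)
  (arc_vertex eG (set21 _ _)) (arc_vertex eG (set22 _ _)) r0.
exists (s' ++ s); split.
- by rewrite /chain cat_path -/(chain r _ s') cs' ls'.
- by rewrite last_cat ls'.
- move=> a; rewrite -cat_cons mem_cat => /orP[/sA' aa|al].
    right; exists [set u; x]%SET => //=; split=> //.
    by apply/fintype.subsetP => y /set2P[] ->; apply: sub; rewrite !inE eqxx ?orbT.
  by apply: sA; rewrite inE al orbT.
Qed.

(** A point [q] of the unbounded face close to [p z] has a potential for the whole drawing.
    Restricted to the part avoiding [z], which is far from [p z], it can be moved from [q] to
    [p z]. *)
Lemma outer_potential z : closure (unbounded_face (drawn_points p gamma)) (p z) ->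
  potential (carrier (~: [set z])%SET) (p z).
Proof.
have [r r0 rP] := carrier_distance.
move=> /(_ (ball (p z) r)) []; first exact: nbhsx_ballx.
move=> q [Fq]; rewrite -ball_normE /= => zq.
have far a : carrier (~: [set z])%SET a -> r *+ 2 <= `|a - p z|.
  move=> ca; apply: (rP (~: [set z])%SET [set z]%SET) => //; 
    first by rewrite disjoint_sym disjoints1 finset.in_setC set11.
  by left; exists z; rewrite //= ?set11.
apply/(potential_step far zq); apply: potential_sub (@carrier_drawn _) _.
by apply: potential_unbounded_face => //; rewrite drawn_pointsE; exact: carrier_compact.
Qed.

(* The parity identity [wind_cross] for two disjoint links, the windings being
   expressed by the potentials at their end vertices. *)
Lemma linked_parity : (forall z, closure (unbounded_face (drawn_points p gamma)) (p z)) ->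
  exists (h : G -> G -> bool), forall S T u v x y,
    linked S u v -> linked T x y -> [disjoint S & T]%B ->
    h x u (+) h x v (+) h y u (+) h y v (+) h u x (+) h u y (+) h v x (+) h v y =
    up (p u - p x) (+) up (p u - p y) (+) up (p v - p x) (+) up (p v - p y).
Proof.
move=> outer; have pot z : exists eh : R * (R * R -> bool), 0 < eh.1 /\
    forall x s, chain eh.1 x s -> (forall a, a \in x :: s -> carrier (~: [set z])%SET a) ->
    wind (p z) x s = eh.2 x (+) eh.2 (last x s).
  by have [e e0 [h hP]] := outer_potential (outer z); exists (e, h).
have [f fP] := choice pot; have [r r0 rP] := carrier_distance.
(* A mesh fine enough for all the potentials and for [wind_cross]. *)
pose m := \big[Num.min/r]_z (f z).1.
have m0 : 0 < m.
  by rewrite /m; elim/big_ind: _ => // [a b a0 b0|z _]; [rewrite lt_min a0|case: (fP z)].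
have mf z : m <= (f z).1 by rewrite /m (bigD1 z) //= ge_min lexx.
have mr : m <= r.
  exact: bigmin_le_id.
exists (fun z u => (f z).2 (p u)) => S T u v x y Suv Txy dST.
have nST w : w \in S -> w \in T -> False.
  by move=> wS wT; have /pred0P/(_ w) := dST; rewrite /= wS wT.
have [uS vS] := linked_mem Suv; have [xT yT] := linked_mem Txy.
have [s [cs ls sS]] := linked_chain Suv m0.
have [t [ct lt tT]] := linked_chain Txy m0.
have avoid w T' : (w \in T' -> False) -> carrier T' `<=` carrier (~: [set w])%SET.
  move=> wT'; apply: carrier_sub; apply/fintype.subsetP => w' w'T'.
  rewrite finset.in_setC finset.in_set1.
  by apply/eqP => ww'; apply: wT'; rewrite -ww'.
have windE w x' s' T' : (w \in T' -> False) -> chain m x' s' ->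
    (forall a, a \in x' :: s' -> carrier T' a) ->
    wind (p w) x' s' = (f w).2 x' (+) (f w).2 (last x' s').
  move=> wT' cs' s'T'; apply: (fP w).2; first exact: chain_le cs'.
  by move=> a /s'T'; exact: avoid.
have := wind_cross (r := r) (fun a b al bl => rP _ _ dST a b (sS _ al) (tT _ bl))
  (chain_le mr cs) (chain_le mr ct).
rewrite lt ls !(windE _ _ _ _ _ cs sS) ?(windE _ _ _ _ _ ct tT) ?lt ?ls; try by move=> ?; eauto.
by move=> <-; rewrite !addbA.
Qed.

End Drawing.

(** * Excluded subdivisions and degeneracy *)

Lemma addb_xorb a b : a (+) b = xorb a b. Proof. by case: a; case: b. Qed.
Section Excluded.
Variables (R : realType) (G : sgraph).
Hypothesis outerG : outerplanar R G.
Implicit Types (S T : {set G}) (u v x y : G).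

(** All that is extracted from a drawing: [h z u] is the potential at [u] for windings around [z],
    and [t u v] tells whether the vector from [v] to [u] is [up]. *)
Lemma outerplanar_parity : exists h t : G -> G -> bool,
  (forall u v, u != v -> t u v = ~~ t v u) /\
  forall S T u v x y, linked S u v -> linked T x y -> [disjoint S & T]%B ->
    h x u (+) h x v (+) h y u (+) h y v (+) h u x (+) h u y (+) h v x (+) h v y =
    t u x (+) t u y (+) t v x (+) t v y.
Proof.
case: outerG => p [gamma [drawing outer]].
have [h hP] := linked_parity drawing outer.
exists h, (fun u v => up (p u - p v)); split=> // u v uv; apply: up_sub.
by rewrite (inj_eq (vertices_inj drawing)).
Qed.

(** Add the parity identities of the three pairs of opposite links. Every [h] term occurs twice, and
    so do [t v1 v2], [t v1 v3], [t v1 v4]; the three other pairs occur once in each orientation and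
    contribute 1 each. *)
Lemma no_K4 (S12 S34 S13 S24 S14 S23 : {set G}) v1 v2 v3 v4 :
  linked S12 v1 v2 -> linked S34 v3 v4 -> [disjoint S12 & S34]%B ->
  linked S13 v1 v3 -> linked S24 v2 v4 -> [disjoint S13 & S24]%B ->
  linked S14 v1 v4 -> linked S23 v2 v3 -> [disjoint S14 & S23]%B -> False.
Proof.
have neq S T u v x y : linked S u v -> linked T x y -> [disjoint S & T]%B ->
    [/\ u != x, u != y, v != x & v != y].
  move=> /linked_mem[uS vS] /linked_mem[xT yT] /pred0P dST.
  have ne a b : a \in S -> b \in T -> a != b.
    by move=> aS bT; apply/eqP => ab; have := dST a; rewrite /= aS ab bT.
  by split; exact: ne.
have [h [t [tN par]]] := outerplanar_parity.
move=> l12 l34 d1 l13 l24 d2 l14 l23 d3.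
have := par _ _ _ _ _ _ l12 l34 d1.
have := par _ _ _ _ _ _ l13 l24 d2.
have := par _ _ _ _ _ _ l14 l23 d3.
have [_ _ n23 n24] := neq _ _ _ _ _ _ l12 l34 d1.
have [_ _ _ n34] := neq _ _ _ _ _ _ l13 l24 d2.
rewrite (tN _ _ n23) (tN _ _ n24) (tN _ _ n34).
move: (h v1 v2) (h v1 v3) (h v1 v4) (h v2 v1) (h v2 v3) (h v2 v4)
  (h v3 v1) (h v3 v2) (h v3 v4) (h v4 v1) (h v4 v2) (h v4 v3) (t v1 v2) (t v1 v3)
  (t v1 v4) (t v3 v2) (t v4 v2) (t v4 v3).
have tr (a b c d e f : bool) : a = b -> c = d -> e = f -> (a (+) c (+) e) = (b (+) d (+) f).
  by move=> -> -> ->.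
move=> h12 h13 h14 h21 h23 h24 h31 h32 h34 h41 h42 h43 t12 t13 t14 t32 t42 t43 E1 E2 E3.
have := tr _ _ _ _ _ _ E1 E2 E3.
have odd_sum (a b : bool) : a = ~~ b -> a = b -> False by move=> ->; case: b.
apply: odd_sum; rewrite !addb_xorb; btauto.
Qed.

Lemma linked_edge (S : {set G}) u v : adj u v -> u \in S -> v \in S -> linked S u v.
Proof.
move=> uv uS vS; exists [:: v]; split=> //=; first by rewrite uv.
by move=> w; rewrite !inE => /orP[] /eqP ->.
Qed.

(** Add the identities of the six pairs of disjoint edges, one at [a] and one at [b]. Only the pairs
    among [x], [y], [z] survive, once in each orientation, so the sum is three times 1. *)
Lemma no_K23 a b x y z : a != b -> x != y -> y != z -> z != x ->
  adj a x -> adj a y -> adj a z -> adj b x -> adj b y -> adj b z -> False.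
Proof.
move=> ab xy yz zx ax ay az bx b_y bz.
have neq u v : adj u v -> u != v by apply: contraTneq => ->; rewrite adj_irrefl.
have [h [t [tN par]]] := outerplanar_parity.
have eqn u v : adj a u -> adj a v -> adj b u -> adj b v -> u != v ->
    h b a (+) h b u (+) h v a (+) h v u (+) h a b (+) h a v (+) h u b (+) h u v =
    t a b (+) t a v (+) t u b (+) t u v.
  move=> au av bu bv uv; apply: (par [set a; u]%SET [set b; v]%SET).
  - by apply: linked_edge; rewrite ?set21 ?set22.
  - by apply: linked_edge; rewrite ?set21 ?set22.
  apply/pred0P => w /=; rewrite !finset.in_set2.
  case: eqVneq => [->|_] /=; first by rewrite (negbTE ab) (negbTE (neq _ _ av)).
  case: eqVneq => [->|//] /=.
  by rewrite (negbTE uv) eq_sym (negbTE (neq _ _ bu)).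
have yx : y != x by rewrite eq_sym.
have zy : z != y by rewrite eq_sym.
have xz : x != z by rewrite eq_sym.
have := eqn _ _ ax ay bx b_y xy; have := eqn _ _ ay ax b_y bx yx.
have := eqn _ _ ay az b_y bz yz; have := eqn _ _ az ay bz b_y zy.
have := eqn _ _ az ax bz bx zx; have := eqn _ _ ax az bx bz xz.
rewrite (tN _ _ xy) (tN _ _ yz) (tN _ _ zx).
have tr (a1 b1 a2 b2 a3 b3 a4 b4 a5 b5 a6 b6 : bool) : a1 = b1 -> a2 = b2 -> a3 = b3 ->
  a4 = b4 -> a5 = b5 -> a6 = b6 ->
  (a1 (+) a2 (+) a3 (+) a4 (+) a5 (+) a6) = (b1 (+) b2 (+) b3 (+) b4 (+) b5 (+) b6).
  by move=> -> -> -> -> -> ->.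
move=> E1 E2 E3 E4 E5 E6; have := tr _ _ _ _ _ _ _ _ _ _ _ _ E1 E2 E3 E4 E5 E6.
have odd_sum (c d : bool) : c = ~~ d -> c = d -> False by move=> ->; case: d.
apply: odd_sum; rewrite !addb_xorb.
move: (h b a) (h b x) (h b y) (h b z) (h a b) (h a x) (h a y) (h a z) (h x a) (h x b)
  (h x y) (h x z) (h y a) (h y b) (h y x) (h y z) (h z a) (h z b) (h z x) (h z y)
  (t a b) (t a x) (t a y) (t a z) (t x b) (t y b) (t z b) (t y x) (t z y) (t x z).
clear; intros; btauto.
Qed.

Lemma common_neighbours a b : a != b -> (#|[set x : G | adj a x && adj b x]%SET| <= 2)%N.
Proof.
move=> ab; rewrite leqNgt; apply/negP => /card_gt2P[x [y [z [[]]]]].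
rewrite !finset.in_set => /andP[ax bx] /andP[ay b_y] /andP[az bz] [xy yz zx].
exact: (no_K23 ab xy yz zx).
Qed.

Lemma linked_cat (S : {set G}) u v w : linked S u v -> linked S v w -> linked S u w.
Proof.
case=> s [ps ls sS] [t [pt lt tS]]; exists (s ++ t); split.
- by rewrite cat_path ps ls.
- by rewrite last_cat ls.
- move=> x; rewrite -cat_cons mem_cat => /orP[/sS//|xt].
  by apply: tS; rewrite inE xt orbT.
Qed.

Lemma linked_sym (S : {set G}) u v : linked S u v -> linked S v u.
Proof.
case=> s [ps ls sS]; exists (rev (belast u s)); split.
- by rewrite -ls rev_path; under eq_path do rewrite adj_sym.
- by case: s {ps} ls sS => [|x s] //= _ _; rewrite rev_cons last_rcons.
- move=> x; rewrite -ls -rev_rcons -lastI mem_rev; exact: sS.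
Qed.

(** * Longest paths and degeneracy *)

Definition simple_path (S : {set G}) s := [&& sorted (@adj G) s, uniq s & all [in S] s].

Definition longest_path (S : {set G}) s :=
  simple_path S s /\ forall t, simple_path S t -> (size t <= size s)%N.

Lemma longest_path_exists (S : {set G}) x : x \in S ->
  exists2 s, longest_path S s & (0 < size s)%N.
Proof.
move=> xS; pose P n := `[< exists2 s, simple_path S s & size s = n >].
have exP : exists n, P n.
  by exists 1%N; apply/asboolP; exists [:: x] => //=; rewrite /simple_path /= xS.
have ubP n : P n -> (n <= #|G|)%N.
  by move=> /asboolP[s /and3P[_ us _] <-]; rewrite -(card_uniqP us) max_card.
case: (ex_maxnP exP ubP) => m /asboolP[s sp <-] max; exists s.
  by split=> // t tp; apply: max; apply/asboolP; exists t.
by apply: max; apply/asboolP; exists [:: x] => //=; rewrite /simple_path /= xS.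
Qed.

Section LongestPath.
Variables (S : {set G}) (s : seq G) (x0 : G).
Hypothesis sP : longest_path S s.

Lemma longest_path_step i : (i.+1 < size s)%N -> adj (nth x0 s i) (nth x0 s i.+1).
Proof. by case: sP => /and3P[/(sortedP x0) + _ _] _; apply. Qed.

Lemma longest_path_uniq : uniq s.
Proof. by case: sP => /and3P[]. Qed.

Lemma longest_path_sub x : x \in s -> x \in S.
Proof. by case: sP => /and3P[_ _ /allP sub] _; exact: sub. Qed.

Lemma longest_path_head x : x \in S -> adj (nth x0 s 0) x -> x \in s.
Proof.
move=> xS ax; apply/negPn/negP => xs; have [/and3P[srt us sS] max] := sP.
suff /max : simple_path S (x :: s) by rewrite ltnn.
rewrite /simple_path /= xS xs us sS !andbT.
by case: s srt ax => //= y s' -> yx; rewrite adj_sym yx.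
Qed.

(** Vertex sets are described by positions on the path, so that disjointness of links becomes
    arithmetic. *)
Definition indices (P : pred nat) : {set G} := [set x | (x \in s) && P (index x s)]%SET.

Lemma mem_indices P i : (i < size s)%N -> ((nth x0 s i) \in indices P) = P i.
Proof.
by move=> lti; rewrite finset.in_set mem_nth //= index_uniq // longest_path_uniq.
Qed.

Lemma indices_disjoint (P Q : pred nat) : (forall i, (i < size s)%N -> P i -> Q i -> False) ->
  [disjoint indices P & indices Q]%B.
Proof.
move=> PQ; apply/pred0P => x /=; rewrite !finset.in_set.
apply/negbTE/negP => /andP[/andP[xs Px] /andP[_ Qx]].
by apply: (PQ (index x s)); rewrite ?index_mem.
Qed.

Lemma linked_indices (P : pred nat) a b : (a <= b < size s)%N ->
  (forall i, (a <= i <= b)%N -> P i) -> linked (indices P) (nth x0 s a) (nth x0 s b).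
Proof.
case/andP=> ab; rewrite -(subnKC ab); elim: (b - a)%N => [|d IH] bs sub.
  exists [::]; split; rewrite /= ?addn0 // => x; rewrite inE => /eqP ->.
  by rewrite mem_indices ?sub //; lia.
apply: linked_cat (IH _ _) _; [by lia|by move=> i ?; apply: sub; lia|].
rewrite addnS; apply: linked_edge; rewrite ?mem_indices ?sub //; try lia.
by apply: longest_path_step; lia.
Qed.

Lemma linked_indices_edge (P : pred nat) a b : adj (nth x0 s a) (nth x0 s b) -> P a -> P b ->
  (a < size s)%N -> (b < size s)%N -> linked (indices P) (nth x0 s a) (nth x0 s b).
Proof. by move=> ab Pa Pb la lb; apply: linked_edge; rewrite ?mem_indices. Qed.

End LongestPath.

(** A rotation in the sense of Posa: the chord from the first vertex to position [k] replaces the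
    edge entering position [k], and the segment before it is reversed. *)
Lemma longest_path_rotate (S : {set G}) s x0 k : longest_path S s -> (0 < k < size s)%N ->
  adj (nth x0 s 0) (nth x0 s k) ->
  longest_path S (rev (take k s) ++ drop k s) /\
  forall i, nth x0 (rev (take k s) ++ drop k s) i =
            if (i < k)%N then nth x0 s (k.-1 - i) else nth x0 s i.
Proof.
move=> sP /andP[k0 ks] a0k.
have nthE i : nth x0 (rev (take k s) ++ drop k s) i =
              if (i < k)%N then nth x0 s (k.-1 - i) else nth x0 s i.
  rewrite nth_cat size_rev size_take ks; case: ltnP => ik.
    rewrite nth_rev size_take ks // nth_take; last by lia.
    by congr nth; lia.
  by rewrite nth_drop subnKC.
split=> //; have pr : perm_eq (rev (take k s) ++ drop k s) s.
  by rewrite -[X in perm_eq _ X](cat_take_drop k) perm_cat2r perm_rev.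
split; last by move=> t /sP.2; rewrite (perm_size pr).
apply/and3P; split.
- apply/(sortedP x0) => i; rewrite (perm_size pr) !nthE => lti.
  case: (ltngtP i.+1 k) => ik.
  + rewrite /= adj_sym (_ : k.-1 - i = (k.-1 - i.+1).+1)%N; last by lia.
    by apply: (longest_path_step x0 sP); lia.
  + exact: (longest_path_step x0 sP).
  + by rewrite -ik subnn ik.
- by rewrite (perm_uniq pr) (longest_path_uniq sP).
- by rewrite (perm_all _ pr); case: sP => /and3P[].
Qed.

Lemma neighbour_outside (S : {set G}) u a b :
  (2 < #|[set v in S | adj u v]%SET|)%N ->
  exists v, [/\ v \in S, adj u v, v != a & v != b].
Proof.
move=> gt2; have : (0 < #|([set v in S | adj u v] :\ a :\ b)%SET|)%N.
  have := cardsD1 b ([set v in S | adj u v] :\ a)%SET.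
  have := cardsD1 a ([set v in S | adj u v])%SET.
  by case: (_ \in _); case: (_ \in _); lia.
case/card_gt0P => v; rewrite !finset.in_setD1 finset.in_set => /and4P[? ? ? ?].
by exists v.
Qed.

(* Among the longest paths, choose one whose first vertex has its second neighbour
   as early as possible; rotating at that neighbour then yields a K4 subdivision. *)
Lemma degree_le2 (S : {set G}) : S != finset.set0 ->
  exists2 v, v \in S & (#|[set u in S | adj v u]%SET| <= 2)%N.
Proof.
case/set0Pn => x0 x0S; apply: contrapT => H.
have deg v : v \in S -> (2 < #|[set u in S | adj v u]%SET|)%N.
  by move=> vS; rewrite ltnNge; apply/negP => le2; apply: H; exists v.
pose Q k := `[< exists2 s, longest_path S s &
  (1 < k < size s)%N /\ adj (nth x0 s 0) (nth x0 s k) >].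
(* The first vertex has at least three neighbours, all on the path; one of them is neither at
   position 1 nor at position [a]. *)
have nbr s a : longest_path S s -> (0 < size s)%N -> exists m,
    [/\ (1 < m < size s)%N, m != a & adj (nth x0 s 0) (nth x0 s m)].
  move=> sP s0; have := deg _ (longest_path_sub sP (mem_nth x0 s0)).
  case/(@neighbour_outside _ _ (nth x0 s 1) (nth x0 s a)) => v [vS av v1 va].
  have vs := longest_path_head sP vS av.
  exists (index v s); rewrite index_mem vs nth_index //; split=> //.
  - rewrite andbT; case E : (index v s) => [|[|i]] //.
    + by move: av; rewrite -(nth_index x0 vs) E adj_irrefl.
    + by move: v1; rewrite -(nth_index x0 vs) E eqxx.
  - by apply: contraNneq va => <-; rewrite nth_index.
have exQ : exists k, Q k.
  have [s sP s0] := longest_path_exists x0S.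
  have [m [m1 _ am]] := nbr s 0 sP s0.
  by exists m; apply/asboolP; exists s.
case: (ex_minnP exQ) => k /asboolP[s sP [/andP[k1 ks] a0k]] kmin.
have k0 : (0 < k < size s)%N by rewrite ks andbT; lia.
have s0 : (0 < size s)%N by lia.
have [rP rE] := longest_path_rotate sP k0 a0k.
set r := rev _ ++ _ in rP rE.
have sr : size r = size s.
  by apply/eqP; rewrite eqn_leq (sP.2 _ rP.1) (rP.2 _ sP.1).
have [j [/andP[j1 js] jk ajr]] : exists j, [/\ (1 < j < size s)%N, j != k &
    adj (nth x0 r 0) (nth x0 r j)].
  by rewrite -sr; apply: nbr => //; rewrite sr.
(* Minimality of [k], applied to the rotated path, puts this neighbour beyond [k], where the
   rotation moves nothing. *)
have kj : (k < j)%N.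
  rewrite ltn_neqAle eq_sym jk; apply: kmin; apply/asboolP; exists r => //.
  by rewrite sr j1.
have {ajr} akj : adj (nth x0 s k.-1) (nth x0 s j).
  by move: ajr; rewrite !rE subn0 (ltnNge j) (ltnW kj) /= (_ : 0 < k)%N //; lia.
have [m [/andP[m1 ms] mk a0m]] := nbr s k sP s0.
have km : (k < m)%N.
  rewrite ltn_neqAle eq_sym mk; apply: kmin; apply/asboolP; exists s => //.
  by rewrite m1.
have kk : k.-1.+1 = k by lia.
have akk : adj (nth x0 s k.-1) (nth x0 s k).
  by rewrite -{2}kk; apply: (longest_path_step x0 sP); lia.
have seg := linked_indices x0 sP.
have edge := @linked_indices_edge S s x0 sP.
have disj := indices_disjoint (s := s).
(* The branch vertices are at the positions 0, [k - 1], [k] and the smaller of [j] and [m]; the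
   stretch from there to the larger one prolongs the chord that ends at the larger one. *)
have [jm|mj] := leqP j m.
- apply: (@no_K4 (indices s [pred i | i <= k.-1]%N) (indices s [pred i | k <= i <= j]%N)
    (indices s [pred i | (i == 0) || (i == k)]%N)
    (indices s [pred i | (i == k.-1) || (i == j)]%N)
    (indices s [pred i | (i == 0) || (j <= i <= m)]%N)
    (indices s [pred i | (i == k.-1) || (i == k)]%N)
    (nth x0 s 0) (nth x0 s k.-1) (nth x0 s k) (nth x0 s j)).
  + by apply: seg => [|i] /=; lia.
  + by apply: seg => [|i] /=; lia.
  + by apply: disj => i _ /=; lia.
  + by apply: edge => //=; lia.
  + by apply: edge => //=; lia.
  + by apply: disj => i _ /=; lia.
  + apply: (@linked_cat _ _ (nth x0 s m)); first by apply: edge => //=; lia.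
    by apply: linked_sym; apply: seg => [|i] /=; lia.
  + by apply: edge => //=; lia.
  + by apply: disj => i _ /=; lia.
- apply: (@no_K4 (indices s [pred i | i <= k.-1]%N) (indices s [pred i | k <= i <= m]%N)
    (indices s [pred i | (i == 0) || (i == k)]%N)
    (indices s [pred i | (i == k.-1) || (m <= i <= j)]%N)
    (indices s [pred i | (i == 0) || (i == m)]%N)
    (indices s [pred i | (i == k.-1) || (i == k)]%N)
    (nth x0 s 0) (nth x0 s k.-1) (nth x0 s k) (nth x0 s m)).
  + by apply: seg => [|i] /=; lia.
  + by apply: seg => [|i] /=; lia.
  + by apply: disj => i _ /=; lia.
  + by apply: edge => //=; lia.
  + apply: (@linked_cat _ _ (nth x0 s j)); first by apply: edge => //=; lia.
    by apply: linked_sym; apply: seg => [|i] /=; lia.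
  + by apply: disj => i _ /=; lia.
  + by apply: edge => //=; lia.
  + by apply: edge => //=; lia.
  + by apply: disj => i _ /=; lia.
Qed.

(** Removing a vertex of degree at most 2 lowers the sum of degrees by at most 4. *)
Lemma sum_degrees (S : {set G}) :
  (\sum_(v in S) #|[set u in S | adj v u]%SET| <= 4 * #|S|)%N.
Proof.
have [n] := ubnP #|S|; elim: n S => // n IH S ltn.
have [->|/degree_le2[v vS dv]] := eqVneq S finset.set0.
  by rewrite big_set0.
have := IH (S :\ v)%SET; rewrite (cardsD1 v S) vS in ltn *.
move=> /(_ ltac:(lia)) le1.
rewrite (big_setD1 v) //=.
have : (\sum_(u in S :\ v) #|[set w in S | adj u w]%SET| <=
   \sum_(u in S :\ v) (#|[set w in S :\ v | adj u w]%SET| + adj v u))%N.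
  apply: leq_sum => u _; rewrite (cardsD1 v) !finset.in_set vS /= addnC adj_sym leq_add2r.
  by apply/subset_leq_card/fintype.subsetP => w; rewrite !finset.in_set -andbA.
rewrite big_split /=; suff : (\sum_(u in S :\ v) adj v u <= 2)%N by lia.
apply: leq_trans dv; rewrite -sum1dep_card big_mkcond [leqRHS]big_mkcond.
apply: leq_sum => u _; rewrite finset.in_setD1.
by case: (u \in S) => //=; rewrite ?andbF //; case: (adj v u); case: (u != v).
Qed.
End Excluded.

(** * Linear forests *)

Definition consecutive (T : eqType) (s : seq T) u v :=
  [&& u \in s, v \in s & ((index u s).+1 == index v s) || ((index v s).+1 == index u s)].

Section Partition.
Variables (R : realType) (G : sgraph).
Hypothesis outerG : outerplanar R G.
Variable w : G.

Lemma longest_path_rev (S : {set G}) s : longest_path S s -> longest_path S (rev s).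
Proof.
case=> /and3P[srt us sS] max; split; last by rewrite size_rev.
rewrite /simple_path rev_uniq us all_rev sS andbT /= andbT rev_sorted.
by rewrite (eq_sorted (e' := @adj G)) // => x y; rewrite adj_sym.
Qed.

(* With [w] adjacent to all of [S], a longest path of [S] is an induced path and a
   connected component: [K_{2,3}] bounds the degrees and [K_4] excludes cycles. *)
Lemma longest_path_component (S : {set G}) s x0 : {in S, forall v, adj w v} ->
    longest_path S s -> forall i y, (i < size s)%N -> y \in S -> adj (nth x0 s i) y ->
  exists j, [/\ (j < size s)%N, y = nth x0 s j & (i.+1 == j) || (j.+1 == i)].
Proof.
move=> wS.
have wNS : w \notin S by apply/negP => /wS; rewrite adj_irrefl.
(* A chord from the first vertex closes a cycle; [w] and the vertices at the positions 0, 1 and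
   [j + 2] would then be the branch vertices of a K4 subdivision. *)
have head s' y : longest_path S s' -> y \in S -> adj (nth x0 s' 0) y ->
    (1 < size s')%N /\ y = nth x0 s' 1.
  move=> sP yS ay; have ys := longest_path_head sP yS ay.
  have := ay; rewrite -(nth_index x0 ys); have := ys; rewrite -index_mem.
  move: (index y s') => j js aj.
  case: j js aj => [|[|j]] js aj; [by rewrite adj_irrefl in aj|by []|exfalso].
  have seg := linked_indices x0 sP.
  have disj := indices_disjoint (s := s').
  have mem i : (i < size s')%N -> nth x0 s' i \in S.
    by move=> ?; apply: (longest_path_sub sP); exact: mem_nth.
  have inj i k : (i < size s')%N -> (k < size s')%N -> (nth x0 s' i == nth x0 s' k) = (i == k).
    by move=> ? ?; apply: nth_uniq => //; exact: longest_path_uniq sP.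
  have edge i : (i < size s')%N -> linked [set w; nth x0 s' i]%SET w (nth x0 s' i).
    by move=> ?; apply: linked_edge; rewrite ?set21 ?set22 //; apply/wS/mem.
  have sep i P : ~~ P i -> (i < size s')%N ->
      [disjoint [set w; nth x0 s' i]%SET & indices s' P]%B.
    move=> Pi ltis; apply/pred0P => x /=; rewrite finset.in_set2.
    apply/negbTE/negP => /andP[/orP[]/eqP ->].
      by rewrite finset.in_set => /andP[/(longest_path_sub sP)]; rewrite (negbTE wNS).
    by rewrite (mem_indices x0 sP) // (negbTE Pi).
  have {}js : (j.+2 < size s')%N := js.
  have j0 : (0 < size s')%N by exact: leq_trans js.
  have j1 : (1 < size s')%N by exact: leq_trans js.
  apply: (@no_K4 _ _ outerG _ (indices s' [pred i | 1 <= i <= j.+2]%N)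
     _ (indices s' [pred i | (i == 0) || (i == j.+2)]%N)
     _ (indices s' [pred i | (i <= 1)]%N)
     w (nth x0 s' 0) (nth x0 s' 1) (nth x0 s' j.+2) (edge 0 j0) _ _ (edge 1 j1) _ _
     (edge j.+2 js)); rewrite ?sep //= ?andbF ?ltnn //.
  - by apply: seg => [|i] /=; lia.
  - by apply: (@linked_indices_edge _ S s' x0 sP) => //=; lia.
  - by apply: seg => [|i] /=; lia.
move=> sP i y ltis yS ay.
have [i0|i0] := posnP i.
  subst i; have [s1 ->] := head _ _ sP yS ay.
  by exists 1%N.
have [il|il] := eqVneq i.+1 (size s).
  have := head _ y (longest_path_rev sP) yS; rewrite !nth_rev ?size_rev; try lia.
  rewrite (_ : (size s - 1)%N = i); last by lia.
  case=> // [s1 ->]; exists (size s - 2)%N; split=> //; [lia|].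
  by apply/orP; right; lia.
have yNi : nth x0 s i != y by apply: contraTneq ay => ->; rewrite adj_irrefl.
have lti : (i.+1 < size s)%N by lia.
have st := longest_path_step x0 sP.
have siS k : (k < size s)%N -> nth x0 s k \in S.
  by move=> ?; apply: (longest_path_sub sP); exact: mem_nth.
have wsi : w != nth x0 s i by apply: contraNneq wNS => ->; exact: siS.
have := common_neighbours outerG wsi.
set N := [set x | _]%SET => cN.
have yN : y \in N by rewrite finset.in_set wS.
have N1 : nth x0 s i.+1 \in N by rewrite finset.in_set wS ?siS // st.
have pi : i.-1.+1 = i by lia.
have N2 : nth x0 s i.-1 \in N.
  rewrite finset.in_set wS /=; last by apply: siS; lia.
  by have := st i.-1; rewrite pi adj_sym; apply.
have [->|y1] := eqVneq y (nth x0 s i.+1); first by exists i.+1; rewrite eqxx.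
have [->|y2] := eqVneq y (nth x0 s i.-1).
  by exists i.-1; split=> //; [lia|rewrite pi eqxx orbT].
(* Otherwise [y] and the two path neighbours of an inner vertex are three common neighbours of that
   vertex and [w]. *)
suff : (2 < #|N|)%N by lia.
apply/card_gt2P; exists y, (nth x0 s i.+1), (nth x0 s i.-1); split; first by split.
have li : (i.-1 < size s)%N by lia.
have ii : (i.+1 == i.-1) = false by lia.
by split; rewrite // 1?eq_sym // eq_sym (nth_uniq _ _ _ (longest_path_uniq sP)) ?ii.
Qed.

(** A longest path is split off at each step; being a component, it sends no edge to the rest. *)
Lemma path_partition (S : {set G}) : {in S, forall v, adj w v} ->
  exists ss : seq (seq G), [/\ uniq (flatten ss), flatten ss =i S, [::] \notin ss &
    {in S &, forall u v, adj u v = has (fun s => consecutive s u v) ss}].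
Proof.
have [n] := ubnP #|S|; elim: n S => // n IH S ltn wS.
have [->|/set0Pn[x0 x0S]] := eqVneq S finset.set0.
  by exists [::]; split=> // [x|x y]; rewrite finset.in_set0.
have [s sP s0] := longest_path_exists x0S.
have sub := longest_path_sub sP.
have comp := longest_path_component (x0 := x0) wS sP.
set S' := (S :\: [set x in s])%SET.
have in_S' x : (x \in S') = (x \notin s) && (x \in S) by rewrite !finset.in_set.
have [||ss [us sS ne con]] := IH S'.
- apply: leq_trans (_ : #|S| <= n)%N => //; apply: proper_card.
  apply/properP; split; first exact: subsetDl.
  exists (nth x0 s 0); first by apply/sub/mem_nth.
  by rewrite in_S' mem_nth.
- by move=> v; rewrite in_S' => /andP[_ /wS].
have sss x : x \in s -> has (fun t => x \in t) ss = false.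
  move=> xs; apply/negbTE/negP => /hasP[t tss xt].
  have : x \in flatten ss by apply/flattenP; exists t.
  by rewrite sS in_S' xs.
have conF u v : (u \in s) || (v \in s) -> has (fun t => consecutive t u v) ss = false.
  move=> uvs; apply/negbTE/negP => /hasP[t tss /and3P[ut vt _]].
  by case/orP: uvs => /sss /negbT/negP; apply; apply/hasP; exists t.
exists (s :: ss); split=> /=.
- rewrite cat_uniq us (longest_path_uniq sP) andbT /=.
  by apply/hasPn => x; rewrite sS in_S' => /andP[].
- by move=> x; rewrite mem_cat sS in_S'; case: (boolP (x \in s)) => //= /sub.
- by rewrite inE negb_or ne andbT; apply: contraTneq s0 => <-.
move=> u v uS vS.
have [us'|us'] := boolP (u \in s).
  rewrite conF ?us' // orbF /consecutive us' /=.
  apply/idP/andP => [auv|[vs]].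
    have := comp (index u s) v; rewrite index_mem us' nth_index //.
    case=> // j [js -> ij]; rewrite mem_nth // index_uniq //.
    exact: longest_path_uniq sP.
  have st := longest_path_step x0 sP.
  case/orP => /eqP ii.
    by have := st (index u s); rewrite ii index_mem vs !nth_index //; apply.
  by have := st (index v s); rewrite ii index_mem us' !nth_index // adj_sym; apply.
rewrite {1}/consecutive (negbTE us') /=.
have [vs|vs] := boolP (v \in s).
  rewrite conF ?vs ?orbT //; apply/negbTE; apply: contra us' => auv.
  have := comp (index v s) u; rewrite index_mem vs nth_index // adj_sym.
  by case=> // j [js -> _]; rewrite mem_nth.
by rewrite con ?in_S' ?us' ?vs.
Qed.

End Partition.

Section Flatten.
Variable (T : eqType).
Implicit Types (s : seq T) (ss : seq (seq T)).

Lemma nth_flatten_inj ss x i j : uniq (flatten ss) ->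
  x \in nth [::] ss i -> x \in nth [::] ss j -> i = j.
Proof.
have mem_nth_flatten tt k : x \in nth [::] tt k -> x \in flatten tt.
  move=> xk; apply/flattenP; exists (nth [::] tt k) => //; apply: mem_nth.
  by rewrite ltnNge; apply/negP => /(nth_default [::]) E; rewrite E in xk.
elim: ss i j => [|s ss IH] [|i] [|j] //=; rewrite ?in_nil // cat_uniq.
- by case/and3P=> _ /hasPn dis _ xs /mem_nth_flatten /dis /negP.
- by case/and3P=> _ /hasPn dis _ /mem_nth_flatten /dis /negP.
- by case/and3P=> _ _ us xi xj; congr _.+1; exact: IH xj.
Qed.

Lemma index_flatten ss s : uniq (flatten ss) -> s \in ss ->
  exists k, {in s, forall x, index x (flatten ss) = (k + index x s)%N}.
Proof.
elim: ss => // t ss IH /=; rewrite cat_uniq => /and3P[_ /hasPn dis us].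
rewrite inE => /predU1P[->|sss].
  by exists 0%N => x xt; rewrite index_cat xt.
have [k kP] := IH us sss; exists (size t + k)%N => x xs.
rewrite index_cat (negbTE (dis x _)) ?kP ?addnA //.
by apply/flattenP; exists s.
Qed.

Lemma consecutive_flatten ss u v : uniq (flatten ss) ->
  has (fun s => consecutive s u v) ss -> consecutive (flatten ss) u v.
Proof.
move=> us /hasP[s sss /and3P[ul vl uv]]; have [k kP] := index_flatten us sss.
have sub x : x \in s -> x \in flatten ss by move=> xs; apply/flattenP; exists s.
by rewrite /consecutive !sub // !kP // -!addnS !eqn_add2l.
Qed.

(** The [j]-th entry of the [i]-th list corresponds to the [j]-th vertex of the [i]-th path. The
    injection [f] lets [F] live on a subtype. *)
Lemma linear_forest_of_partition (F : sgraph) (f : F -> T) (x0 : T) ss :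
    injective f -> uniq (flatten ss) -> [::] \notin ss ->
    (forall y, reflect (exists x, f x = y) (y \in flatten ss)) ->
    (forall u v, adj u v = has (fun s => consecutive s (f u) (f v)) ss) ->
  linear_forest F.
Proof.
move=> injf us ne imf adjE.
(* The paths of a linear forest have [(k i).+1] vertices; the predecessor is exact because no list
   is empty. *)
pose k (i : 'I_(size ss)) := (size (nth [::] ss i)).-1.
pose DU := disjoint_union (fun i => path_graph (k i).+1).
have kE i : (k i).+1 = size (nth [::] ss i).
  by rewrite prednK // lt0n size_eq0; apply: contraNneq ne => <-; exact: mem_nth.
pose val (u : DU) := nth x0 (nth [::] ss (tag u)) (tagged u).
have ltk (u : DU) : (tagged u < size (nth [::] ss (tag u)))%N by rewrite -kE.
have val_mem u : val u \in nth [::] ss (tag u) by exact: mem_nth.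
have usi i : uniq (nth [::] ss i).
  have [lti|/(nth_default [::]) -> //] := ltnP i (size ss).
  apply: subseq_uniq us; elim: (ss) i lti => // s ss' IH [|i] /=.
    by rewrite prefix_subseq.
  by rewrite ltnS => /IH /subseq_trans; apply; exact: suffix_subseq.
have val_inj : injective val.
  move=> u v uv; have tuv : tag u = tag v.
    by apply/val_inj/(nth_flatten_inj us (val_mem u)); rewrite uv.
  case: u v uv tuv => [i j] [i' j'] /= + ii'; subst i' => /eqP.
  rewrite /val /= nth_uniq ?usi -?kE // => /eqP /val_inj -> //.
have exh x : exists u : DU, val u = f x.
  have /flattenP[s sss fxs] : f x \in flatten ss by apply/imf; exists x.
  have lti : (index s ss < size ss)%N by rewrite index_mem.
  have ltj : (index (f x) s < (k (Ordinal lti)).+1)%N.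
    by rewrite kE /= nth_index // index_mem.
  exists (Tagged (fun i => 'I_(k i).+1) (Ordinal ltj : 'I_(k (Ordinal lti)).+1)).
  by rewrite /val /= nth_index // nth_index.
have [h hP] := choice exh.
have exg u : exists x, h x = u.
  have /imf[x fx] : val u \in flatten ss.
    by apply/flattenP; exists (nth [::] ss (tag u)); rewrite ?mem_nth.
  by exists x; apply: val_inj; rewrite hP.
have [g gP] := choice exg.
have hg : cancel h g by move=> x; apply: injf; rewrite -hP gP hP.
exists (size ss), k, h; first by exists g.
move=> x y; rewrite adjE -!hP.
move: (h x) (h y) => u v.
rewrite /= /union_adj; apply/andP/hasP => [[/eqP]|[s sss /and3P[us' vs' uv]]].
- case: u v => [i j] [i' j'] /= ii'; subst i'; rewrite tagged_asE /path_adj => ij.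
  exists (nth [::] ss i); first exact/mem_nth/ltn_ord.
  rewrite /consecutive /val /=.
  by rewrite !mem_nth -?kE // !index_uniq -?kE.
- have [i [lti si]] : exists i, (i < size ss)%N /\ nth [::] ss i = s.
    by exists (index s ss); rewrite index_mem nth_index.
  have tu : tag u = i :> nat.
    by apply: (nth_flatten_inj us (val_mem u)); rewrite si.
  have tv : tag v = i :> nat.
    by apply: (nth_flatten_inj us (val_mem v)); rewrite si.
  have : tag u = tag v by apply: ord_inj; rewrite tu.
  rewrite -si -tu in uv; move: uv.
  case: u v {tu tv us' vs'} => [a j] [a' j'] /= + aa'; subst a'; rewrite eqxx tagged_asE.
  by rewrite /val /= !index_uniq -?kE.
Qed.
End Flatten.

(** * Drawing a fan *)

Section Fan.
Variable R : realType.

Lemma continuous_pair (f g : R -> R) : continuous f -> continuous g ->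
  continuous (fun t => (f t, g t)).
Proof. by move=> cf cg t; exact: (cvg_pair (cf t) (cg t)). Qed.

Lemma vertical_ray_connected (x y c : R) :
  connected ((fun t => (x, y + c * t)) @` `[0, +oo[).
Proof.
apply: connected_continuous_connected.
  by apply/connected_intervalP; exact: interval_is_interval.
apply: continuous_subspaceT; apply: continuous_pair => t; first exact: cvg_cst.
by apply: cvgD; [exact: cvg_cst|exact: mulrl_continuous].
Qed.

(** The vertical ray is connected, avoids [D] and leaves every ball. *)
Lemma unbounded_face_ray (D : set (R * R)) (x y c : R) : c != 0 ->
  (forall t, 0 <= t -> ~ D (x, y + c * t)) -> unbounded_face D (x, y).
Proof.
move=> c0 H; split; first by have := H 0 (lexx _); rewrite mulr0 addr0.
case=> M [_ /(_ (M + 1))]; rewrite ltrDl ltr01 => /(_ isT) bM.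
pose t := (`|M + 1| + `|y| + 1) / `|c|.
have t0 : 0 <= t by rewrite divr_ge0 // !addr_ge0.
have : connected_component (~` D) (x, y) (x, y + c * t).
  apply: (connected_component_max (B := (fun t => (x, y + c * t)) @` `[0, +oo[)).
  - by exists 0; rewrite ?mulr0 ?addr0 //= in_itv /= lexx.
  - by move=> _ [s /= + <-]; rewrite in_itv /= andbT; exact: H.
  - exact: vertical_ray_connected.
  - by exists t; rewrite //= in_itv /= t0.
move/bM; rewrite /= prod_normE ge_max => /andP[_ /=].
apply/negP; rewrite -ltNge (addrC y); have := lerB_normD (c * t) y.
have -> : `|c * t| = `|M + 1| + `|y| + 1.
  by rewrite normrM (ger0_norm t0) /t mulrCA divff ?normr_eq0 // mulr1.
by have := ler_norm (M + 1); lra.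
Qed.

Lemma nat_add_fraction (m n : nat) (s t : R) : 0 <= s < 1 -> 0 <= t < 1 ->
  m%:R + s = n%:R + t -> m = n.
Proof.
move=> /andP[s0 s1] /andP[t0 t1] mn; apply/eqP; rewrite eqn_leq.
apply/andP; split; rewrite -ltnS -(ltr_nat R) -natr1; lra.
Qed.

Variables (H : sgraph) (w : H) (pos : H -> nat).
Hypothesis pos_inj : {in predC1 w &, injective pos}.
Hypothesis pos_adj : forall u v, adj u v -> u != w -> v != w ->
  (pos u).+1 = pos v \/ (pos v).+1 = pos u.

(** The hub is the origin and the other vertices are integer points at height 1; spokes are straight
    and the remaining edges are unit intervals. *)
Let pt (v : H) : R * R := if v == w then (0, 0) else ((pos v)%:R, 1).

Let segment (u v : H) (t : R) : R * R :=
  if u == w then (t * (pos v)%:R, t) else ((pos u)%:R + t, 1).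

(** Arcs are indexed by unordered edges but need a direction: away from the hub, or to the right. *)
Let oriented (u v : H) :=
  [&& adj u v, v != w & (u == w) || ((pos u).+1 == pos v)].

Let gamma (e : {set H}) : R -> R * R :=
  if [pick u : H * H | oriented u.1 u.2 && (e == [set u.1; u.2]%SET)] is Some u
  then segment u.1 u.2 else fun=> 0.

Let gammaP e : e \in edges H ->
  exists u v, [/\ oriented u v, e = [set u; v]%SET & gamma e = segment u v].
Proof.
move=> /edgesP[u [v [uv euv]]]; rewrite /gamma.
case: pickP => [[a b] /andP[ori /eqP eab]|no_orientation].
  by exists a, b.
have := no_orientation (v, u); rewrite /= euv (finset.setUC [set u]%SET) eqxx andbT.
have := no_orientation (u, v); rewrite /= euv eqxx andbT.
rewrite /oriented uv adj_sym uv /=.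
have nuv : u != v by apply: contraTneq uv => ->; rewrite adj_irrefl.
have [uw|uw] := eqVneq u w; have [vw|vw] := eqVneq v w => //=.
- by rewrite uw vw eqxx in nuv.
- by case: (pos_adj uv uw vw) => -> //; rewrite eqxx.
Qed.

Let segment_end u v : oriented u v -> segment u v 0 = pt u /\ segment u v 1 = pt v.
Proof.
rewrite /segment /pt /oriented => /and3P[_ vw]; rewrite (negbTE vw).
have [->|uw] := eqVneq u w; first by rewrite !mul0r !mul1r.
by move=> /= /eqP puv; rewrite addr0 natr1 puv.
Qed.

Let pt_inj : injective pt.
Proof.
move=> u v; rewrite /pt.
have [->|uw] := eqVneq u w; have [->|vw] := eqVneq v w => //.
- by case=> _ /eqP; rewrite eq_sym oner_eq0.
- by case=> _ /eqP; rewrite oner_eq0.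
- by case=> /eqP; rewrite eqr_nat => /eqP; exact: pos_inj.
Qed.

Let fan_drawing : crossing_free_drawing pt gamma.
Proof.
split.
- exact: pt_inj.
- move=> e /gammaP[u [v [_ _ ->]]]; apply: continuous_subspaceT; rewrite /segment.
  case: eqP => _; apply: continuous_pair => t.
  + exact: mulrr_continuous.
  + exact: cvg_id.
  + by apply: cvgD; [exact: cvg_cst|exact: cvg_id].
  + exact: cvg_cst.
- move=> e /gammaP[u [v [_ _ ->]]] s t _ _; rewrite /segment.
  by case: eqP => _; [case|case=> /addrI].
- move=> e /gammaP[u [v [/segment_end[E0 E1] -> ->]]]; apply/seteqP; split.
    move=> _ [t [] -> <-]; rewrite (E0, E1); first by exists u => //=; rewrite set21.
    by exists v => //=; rewrite set22.
  move=> _ [x /= /set2P[] -> <-]; first by exists 0 => //; left.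
  by exists 1 => //; right.
- move=> e x t /gammaP[u [v [_ _ ->]]]; rewrite in_itv /= => /andP[t0 t1].
  rewrite /segment /pt; case: eqP => _; case: eqP => _.
  + by case=> _ /eqP; rewrite gt_eqF.
  + by case=> _ /eqP; rewrite lt_eqF.
  + by case=> _ /eqP; rewrite oner_eq0.
  + case=> E; have E' : (pos u)%:R + t = (pos x)%:R + 0 by rewrite addr0.
    have := nat_add_fraction _ _ E'; rewrite (ltW t0) t1 lexx ltr01 => /(_ isT isT) ux.
    by move: E'; rewrite ux => /addrI /eqP; rewrite gt_eqF.
- move=> e e' s t /gammaP[u [v [ori -> ->]]] /gammaP[u' [v' [ori' -> ->]]] ne.
  rewrite !in_itv /= => /andP[s0 s1] /andP[t0 t1] E; case/eqP: ne.
  move: E ori ori'; rewrite /segment /oriented.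
  have [->|uw] := eqVneq u w; have [->|uw'] := eqVneq u' w; rewrite /=.
  + case=> + st; rewrite -st => /(mulfI (lt0r_neq0 s0)) /eqP; rewrite eqr_nat => /eqP vv'.
    move=> /and3P[_ vw _] /and3P[_ vw' _].
    by rewrite (pos_inj _ _ vv').
  + by case=> _ /eqP; rewrite lt_eqF.
  + by case=> _ /eqP; rewrite gt_eqF.
  + case=> /nat_add_fraction; rewrite (ltW s0) (ltW t0) s1 t1 => /(_ isT isT) uu'.
    move=> /and3P[_ vw /eqP uv] /and3P[_ vw' /eqP uv'].
    by rewrite (pos_inj _ _ uu') // (pos_inj (x := v) (y := v')) // -uv -uv' uu'.
Qed.

(** The drawing lies between the heights 0 and 1, so vertical rays starting just below the hub, or
    just above another vertex, avoid it. *)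
Lemma fan_outerplanar : outerplanar R H.
Proof.
exists pt, gamma; split; first exact: fan_drawing.
have drawn a : drawn_points pt gamma a -> 0 <= a.2 <= 1.
  case=> [[x _ <-]|[e /= /gammaP[u [v [_ _ ->]]] [t /= + <-]]].
    by rewrite /pt; case: eqP; rewrite /= ?lexx ler01.
  by rewrite in_itv /segment; case: eqP; rewrite /= ?lexx ?ler01.
move=> x B /nbhs_ballP[r /= r0 rB]; pose c := if x == w then -1 else 1 : R.
have c0 : c != 0 by rewrite /c; case: (x == w); rewrite ?oppr_eq0 oner_eq0.
exists ((pt x).1, (pt x).2 + c * (r / 2)); split.
  apply: (unbounded_face_ray c0) => t t0 /drawn /= /andP[].
  by rewrite /c /pt; case: (x == w) => /=; lra.
apply: rB; rewrite -ball_normE /= prod_normE /= subrr normr0 opprD addrA subrr add0r.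
rewrite normrN normrM (_ : `|c| = 1) ?mul1r; last first.
  by rewrite /c; case: (x == w); rewrite ?normrN normr1.
rewrite gt_max r0 ger0_norm ?divr_ge0 ?ltW //.
by rewrite ltr_pdivrMr // mulr_natr mulr2n ltrDl.
Qed.
End Fan.

(** * Extreme eigenvalues *)

Section Rayleigh.
Variables (R : realType) (T : finType) (a : T -> T -> R).
Hypothesis a_sym : forall u v, a u v = a v u.
Implicit Types x y : T -> R.

Let form x y := \sum_u \sum_v a u v * x u * y v.
Let norm2 x := \sum_u x u ^+ 2.

Lemma continuous_sumR (V : topologicalType) (I : finType) (F : I -> V -> R) :
  (forall i, continuous (F i)) -> continuous (fun v => \sum_i F i v).
Proof.
move=> cF; apply: continuous_big => // u; exact: add_continuous.
Qed.

(** The maximum is attained on the compact unit sphere, and homogeneity extends the bound to all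
    [y]. *)
Lemma rayleigh_maximum (t0 : T) : exists x, norm2 x = 1 /\
  forall y, form y y <= form x x * norm2 y.
Proof.
pose fn (V : 'rV[R]_#|T|) u := V 0 (enum_rank u).
have cfn u : continuous (fun V => fn V u) by move=> V; exact: coord_continuous.
have cform : continuous (fun V => form (fn V) (fn V)).
  apply: continuous_sumR => u; apply: continuous_sumR => v V.
  exact: (cvgM (cvgM (cvg_cst _) (cfn u V)) (cfn v V)).
have cnorm : continuous (fun V => norm2 (fn V)).
  apply: continuous_sumR => u V; exact: (cvgM (cfn u V) (cfn u V)).
pose K := [set V | norm2 (fn V) = 1].
have normK V u : norm2 (fn V) = 1 -> `|fn V u| <= 1.
  move=> V1; rewrite -(@expr_le1 _ 2) // -normrX ger0_norm ?sqr_ge0 // -V1.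
  by rewrite /norm2 (bigD1 u) //= lerDl sumr_ge0 // => v _; exact: sqr_ge0.
have cK : compact K.
  apply: bounded_closed_compact; last first.
    by rewrite (_ : K = (fun V => norm2 (fn V)) @^-1` [set 1]) //;
      apply: preimage_closed => // V _; exact: cnorm.
  exists 1; split; first exact: num_real.
  move=> M M1 V VK; rewrite /= [`|V|]mx_normrE; apply: bigmax_le.
    by rewrite ltW // (lt_trans ltr01).
  move=> [i j] _ /=; rewrite (ord1 i) -(enum_valK j) (le_trans (normK _ _ VK)) // ltW //.
have fnK x : fn (\row_i x (enum_val i)) = x.
  by apply/funext => u; rewrite /fn mxE enum_rankK.
have K0 : K !=set0.
  exists (\row_i (enum_val i == t0)%:R); rewrite /K /=.
  rewrite (fnK (fun u => (u == t0)%:R)) /norm2 (bigD1 t0) //= eqxx expr1n big1 ?addr0 //.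
  by move=> u /negbTE ->; rewrite mulr0n expr0n.
have [V] := compact_EVT_max K0 cK (continuous_subspaceT cform).
rewrite inE => VK max; exists (fn V); split=> // y.
have N0 : 0 <= norm2 y by apply: sumr_ge0 => u _; exact: sqr_ge0.
have [y0|y0] := eqVneq (norm2 y) 0.
  have yu u : y u = 0.
    by apply/eqP; rewrite -sqrf_eq0; move/psumr_eq0P : y0 => /(_ (fun _ _ => sqr_ge0 _)) ->.
  rewrite y0 mulr0 /form big1 // => u _; rewrite big1 // => v _.
  by rewrite yu mulr0 mul0r.
have Ny : 0 < norm2 y by rewrite lt_neqAle eq_sym y0.
pose s := Num.sqrt (norm2 y); have s2 : s ^+ 2 = norm2 y by rewrite sqr_sqrtr.
have s0 : s != 0 by rewrite -sqrf_eq0 s2.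
pose z u := y u / s.
have zK : (\row_i z (enum_val i)) \in K.
  rewrite inE /K /= fnK /norm2 /z; under eq_bigr do rewrite expr_div_n.
  by rewrite -mulr_suml s2 divff.
have := max _ zK; rewrite fnK -(ler_pM2r Ny); congr (_ <= _).
rewrite -s2 /form mulr_suml; apply: eq_bigr => u _; rewrite mulr_suml.
by apply: eq_bigr => v _; rewrite /z; field.
Qed.

(** Moving a maximiser [x] by [t] times its residual [g] changes the form minus [c] times the
    squared norm by [2 t |g|^2 + O(t^2)]. This is never positive, so [g] vanishes. *)
Lemma rayleigh_eigenvector (t0 : T) : exists x c, [/\ exists u, x u != 0,
  forall u, \sum_v a u v * x v = c * x u & forall y, form y y <= c * norm2 y].
Proof.
have [x [x1 max]] := rayleigh_maximum t0; exists x, (form x x); split=> //.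
  apply: contrapT => x0; move: x1; rewrite /norm2 big1.
    by move/eqP; rewrite eq_sym oner_eq0.
  by move=> u _; apply/eqP; rewrite sqrf_eq0; apply/negPn/negP => xu; apply: x0; exists u.
set c := form x x in max *.
pose g u := \sum_v a u v * x v - c * x u.
have lin (t : R) : form (fun u => x u + t * g u) (fun u => x u + t * g u)
    - c * norm2 (fun u => x u + t * g u) =
    t * norm2 g *+ 2 + t ^+ 2 * (form g g - c * norm2 g).
  have -> : form (fun u => x u + t * g u) (fun u => x u + t * g u) =
      c + t * (\sum_u g u * \sum_v a u v * x v) *+ 2 + t ^+ 2 * form g g.
    rewrite /form.
    have -> : \sum_u g u * (\sum_v a u v * x v) = \sum_u \sum_v a u v * g u * x v.
      by apply: eq_bigr => u _; rewrite mulr_sumr; apply: eq_bigr => v _; ring.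
    have E : \sum_u \sum_v a u v * g u * x v = \sum_u \sum_v a u v * x u * g v.
      rewrite exchange_big; apply: eq_bigr => u _; apply: eq_bigr => v _.
      by rewrite a_sym; ring.
    rewrite mulr2n {2}E /c /form !mulr_sumr -!big_split; apply: eq_bigr => u _ /=.
    by rewrite !mulr_sumr -!big_split; apply: eq_bigr => v _ /=; ring.
  have -> : norm2 (fun u => x u + t * g u) =
      1 + t * (\sum_u g u * x u) *+ 2 + t ^+ 2 * norm2 g.
    rewrite -x1 /norm2 mulr2n !mulr_sumr -!big_split; apply: eq_bigr => u _ /=; ring.
  have -> : norm2 g = \sum_u g u * (\sum_v a u v * x v) - c * (\sum_u g u * x u).
    rewrite mulr_sumr -sumrB; apply: eq_bigr => u _; rewrite /g; ring.
  ring.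
suff g0 : norm2 g = 0.
  move=> u; apply/eqP; rewrite -subr_eq0 -/(g u) -sqrf_eq0.
  by move/psumr_eq0P : g0 => /(_ (fun _ _ => sqr_ge0 _)) ->.
have N0 : 0 <= norm2 g by apply: sumr_ge0 => u _; exact: sqr_ge0.
set k := form g g - c * norm2 g in lin.
have H t : t * norm2 g *+ 2 + t ^+ 2 * k <= 0 by rewrite -lin subr_le0 max.
apply/eqP; rewrite eq_le N0 andbT leNgt; apply/negP => Ng.
have D : 0 < 1 + `|k| by rewrite ltr_pwDl.
(* Small enough for the linear term to dominate the quadratic one. *)
pose t := norm2 g / (1 + `|k|).
have t0' : 0 < t by rewrite divr_gt0.
have := H t; apply/negP; rewrite -ltNge.
have -> : t * norm2 g *+ 2 + t ^+ 2 * k = t * (norm2 g *+ 2 + t * k) by ring.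
apply: mulr_gt0 => //.
have : t * `|k| <= norm2 g.
  by rewrite /t mulrAC ler_pdivrMr // ler_pM2l // lerDr.
have := ler_norm (- (t * k)); rewrite normrN normrM (gtr0_norm t0').
lra.
Qed.
End Rayleigh.

(** * The extreme points of the spectrum *)

Section Spectrum.
Variables (R : realType) (G : sgraph).
Implicit Types x y : G -> R.

Lemma spectrumP (c : R) : @spectrum R G c <->
  exists x, (exists u, x u != 0) /\ forall u, \sum_(v | adj u v) x v = c * x u.
Proof.
split.
- move=> /eigenvalueP[V VA V0]; exists (fun u => V 0 (enum_rank u)); split.
    apply: contrapT => V0'; case/eqP: V0; apply/rowP => j; rewrite mxE.
    apply/eqP/negPn/negP => Vj; apply: V0'; exists (enum_val j).
    by rewrite enum_valK.
  move=> u; move/rowP: VA => /(_ (enum_rank u)); rewrite !mxE => <-.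
  rewrite (reindex (@enum_rank G)) /=; last exact/onW_bij/enum_rank_bij.
  rewrite [LHS]big_mkcond; apply: eq_bigr => v _; rewrite mxE !enum_rankK adj_sym.
  by case: adj; rewrite ?mulr1 ?mulr0.
- case=> x [[u xu] xA]; apply/eigenvalueP; exists (\row_i x (enum_val i)); last first.
    apply: contraNneq xu => /rowP/(_ (enum_rank u)).
    by rewrite !mxE enum_rankK => ->.
  apply/rowP => j; rewrite !mxE -xA.
  rewrite (reindex (@enum_rank G)) /=; last exact/onW_bij/enum_rank_bij.
  rewrite [RHS]big_mkcond; apply: eq_bigr => v _; rewrite !mxE !enum_rankK adj_sym.
  by case: adj; rewrite ?mulr1 ?mulr0.
Qed.

Lemma eigenvalue_form c x : (forall u, \sum_(v | adj u v) x v = c * x u) ->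
  \sum_u \sum_(v | adj u v) x u * x v = c * \sum_u x u ^+ 2.
Proof.
move=> xA; rewrite mulr_sumr; apply: eq_bigr => u _.
by rewrite -mulr_sumr xA; ring.
Qed.

Lemma norm2_gt0 x u : x u != 0 -> 0 < \sum_u x u ^+ 2.
Proof.
move=> xu; rewrite (bigD1 u) //= ltr_pwDl ?sumr_ge0 // => [|v _]; last exact: sqr_ge0.
by rewrite lt_neqAle eq_sym sqrf_eq0 xu sqr_ge0.
Qed.

Lemma spectrum_max (g0 : G) : exists x, [/\ exists u, x u != 0,
  forall u, \sum_(v | adj u v) x v = sup (@spectrum R G) * x u &
  forall y, \sum_u \sum_(v | adj u v) y u * y v <=
    sup (@spectrum R G) * \sum_u y u ^+ 2].
Proof.
have [|x [c [[u xu] xA max]]] := @rayleigh_eigenvector R G (fun u v => (adj u v)%:R) _ g0.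
  by move=> u v; rewrite adj_sym.
have AE (z : G -> R) v : \sum_(w | adj v w) z w = \sum_w (adj v w)%:R * z w.
  by rewrite big_mkcond; apply: eq_bigr => w _; case: adj; rewrite ?mul1r ?mul0r.
have xA' v : \sum_(w | adj v w) x w = c * x v by rewrite AE xA.
have max' y : \sum_u \sum_(v | adj u v) y u * y v <= c * \sum_u y u ^+ 2.
  apply: le_trans (max y); apply: ler_sum => v _; rewrite -mulr_sumr AE mulr_sumr.
  by apply: ler_sum => w _; rewrite mulrCA mulrA.
suff -> : sup (@spectrum R G) = c by exists x; split=> //; exists u.
have cS : @spectrum R G c by apply/spectrumP; exists x; split=> //; exists u.
have ub : ubound (@spectrum R G) c.
  move=> d /spectrumP[y [[v yv] yA]]; rewrite -(ler_pM2r (norm2_gt0 yv)).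
  by rewrite -(eigenvalue_form yA).
apply/eqP; rewrite eq_le; apply/andP; split; first by apply: ge_sup => //; exists c.
by apply: ub_le_sup => //; exists c.
Qed.

(** The maximum principle for the negated adjacency matrix. *)
Lemma spectrum_min (g0 : G) : exists x, [/\ exists u, x u != 0,
  forall u, \sum_(v | adj u v) x v = inf (@spectrum R G) * x u &
  forall y, inf (@spectrum R G) * \sum_u y u ^+ 2 <=
    \sum_u \sum_(v | adj u v) y u * y v].
Proof.
have [|x [c [[u xu] xA max]]] := @rayleigh_eigenvector R G (fun u v => - (adj u v)%:R) _ g0.
  by move=> u v; rewrite adj_sym.
have AE (z : G -> R) v : \sum_(w | adj v w) z w = - \sum_w - (adj v w)%:R * z w.
  rewrite -sumrN big_mkcond; apply: eq_bigr => w _.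
  by case: adj; rewrite mulNr opprK ?mul1r ?mul0r.
have xA' v : \sum_(w | adj v w) x w = - c * x v by rewrite AE xA mulNr.
have min y : - c * \sum_u y u ^+ 2 <= \sum_u \sum_(v | adj u v) y u * y v.
  rewrite mulNr lerNl; apply: le_trans (max y); rewrite -sumrN.
  apply: ler_sum => v _; rewrite -mulr_sumr AE mulrN opprK mulr_sumr.
  by apply: ler_sum => w _; rewrite mulrCA mulrA.
suff -> : inf (@spectrum R G) = - c by exists x; split=> //; exists u.
have cS : @spectrum R G (- c) by apply/spectrumP; exists x; split=> //; exists u.
have lb : lbound (@spectrum R G) (- c).
  move=> d /spectrumP[y [[v yv] yA]]; rewrite -(ler_pM2r (norm2_gt0 yv)).
  by rewrite -(eigenvalue_form yA).
apply/eqP; rewrite eq_le; apply/andP; split; last by apply: lb_le_inf => //; exists (- c).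
by apply: ge_inf => //; exists (- c).
Qed.
(** The absolute values of an eigenvector for the smallest eigenvalue serve as a test vector for the
    largest one. *)
Lemma norm_inf_spectrum_le (g0 : G) :
  `|inf (@spectrum R G)| <= sup (@spectrum R G).
Proof.
have [_ [_ _ max]] := spectrum_max g0.
have [z [[u zu] zA _]] := spectrum_min g0.
have N0 := norm2_gt0 zu; rewrite -(ler_pM2r N0).
have := max (fun v => `|z v|).
under [X in _ <= _ * X]eq_bigr do rewrite real_normK ?num_real //.
apply: le_trans; rewrite -[X in _ * X](gtr0_norm N0) -normrM -(eigenvalue_form zA).
rewrite (le_trans (ler_norm_sum _ _ _)) // ler_sum // => v _.
rewrite (le_trans (ler_norm_sum _ _ _)) // ler_sum // => t _.
by rewrite normrM.
Qed.
End Spectrum.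

(** * Eigenvectors near the hub *)

Section Eigenpair.
Variables (R : realType) (G : sgraph).
Implicit Types (z : G -> R) (c : R).

Definition degree (u : G) := #|[set v | adj u v]%SET|.

Definition eigenpair c z (w : G) := [/\ z w = 1, forall u, `|z u| <= 1 &
  forall u, \sum_(v | adj u v) z v = c * z u].

Lemma eigenpair_of_eigenvector c z : (exists u, z u != 0) ->
  (forall u, \sum_(v | adj u v) z v = c * z u) ->
  exists w y, eigenpair c y w.
Proof.
move=> [u0 zu0] zA.
have [w wP] : exists w, forall u, `|z u| <= `|z w|.
  by exists [arg max_(w > u0) `|z w|]%O; case: arg_maxP => // w _ H u; exact: H.
have zw : 0 < `|z w| by rewrite (lt_le_trans _ (wP u0)) ?normr_gt0.
exists w, (fun u => z u / z w); split.
- by rewrite divff // -normr_gt0.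
- by move=> u; rewrite normrM normfV ler_pdivrMr // mul1r.
- by move=> u; rewrite -mulr_suml zA mulrA.
Qed.

Lemma sum_count (P : pred G) (x : R) : \sum_(v | P v) x = #|[set v | P v]%SET|%:R * x.
Proof. by rewrite -sum1dep_card natr_sum mulr_suml; under [RHS]eq_bigr do rewrite mul1r. Qed.

Lemma degree_sum u : (degree u)%:R = \sum_(v | adj u v) (1 : R).
Proof. by rewrite sum_count mulr1. Qed.

Hypothesis outerG : outerplanar R G.

Lemma sum_degrees_in (S : {set G}) :
  \sum_(u in S) \sum_(t in S | adj u t) (1 : R) <= 4 * #|S|%:R.
Proof.
have := sum_degrees outerG S; rewrite -(ler_nat R) natrM natr_sum.
move=> le4; apply: le_trans le4; apply: ler_sum => u _.
by rewrite sum_count mulr1.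
Qed.

Lemma sum_degree_le : \sum_u (degree u)%:R <= 4 * #|G|%:R :> R.
Proof.
have := sum_degrees_in finset.setT; rewrite finset.cardsT; apply: le_trans.
rewrite [X in _ <= X](eq_bigl xpredT) => [|u]; last by rewrite finset.in_setT.
apply: ler_sum => u _; rewrite degree_sum le_eqVlt; apply/orP; left; apply/eqP.
by apply: eq_bigl => v; rewrite finset.in_setT.
Qed.

(** Expand [c^2 z w] over walks of length two from [w]: returning walks give the degree, and any
    other end point is reached at most twice. The sum of all [|z u|] is controlled by the sum of
    degrees. *)
Lemma eigenvalue_degree c z w : eigenpair c z w ->
  `|c| ^+ 3 <= `|c| * (degree w)%:R + 8 * #|G|%:R.
Proof.
case=> zw z1 zA; set k := `|c|; have k0 : 0 <= k by exact: normr_ge0.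
have kz u : k * `|z u| <= (degree u)%:R.
  rewrite -normrM -zA degree_sum (le_trans (ler_norm_sum _ _ _)) //.
  by apply: ler_sum => v _.
have S : k * \sum_u `|z u| <= 4 * #|G|%:R.
  by rewrite mulr_sumr (le_trans _ sum_degree_le) // ler_sum.
have E : c ^+ 2 = \sum_u \sum_(v | adj w v && adj u v) z u.
  rewrite expr2 -[X in _ * X]mulr1 -zw -zA mulr_sumr.
  under eq_bigr do rewrite -zA.
  rewrite (exchange_big_dep xpredT) //=; apply: eq_bigr => u _.
  by apply: eq_bigl => v; rewrite (adj_sym v u).
have k2 : k ^+ 2 <= (degree w)%:R + 2 * \sum_u `|z u|.
  rewrite -normrX E (bigD1 w) //= zw (le_trans (ler_normD _ _)) // lerD //.
    rewrite sum_count mulr1 ger0_norm // ler_nat subset_leq_card //.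
    by apply/fintype.subsetP => v; rewrite !finset.in_set => /andP[].
  rewrite (le_trans (ler_norm_sum _ _ _)) // mulr_sumr [X in _ <= X](bigD1 w) //=.
  rewrite ler_wpDl ?mulr_ge0 // ler_sum // => u uw.
  rewrite sum_count normrM ger0_norm // ler_wpM2r // (ler_nat R _ 2).
  by rewrite (common_neighbours outerG) // eq_sym.
rewrite exprS; have := ler_wpM2l k0 k2; lra.
Qed.

Definition nonneighbours (w : G) := [set v | (v != w) && ~~ adj w v]%SET.

Lemma hub_split (w : G) (f : G -> R) : \sum_u f u =
  f w + (\sum_(u | adj w u) f u + \sum_(u in nonneighbours w) f u).
Proof.
rewrite (bigD1 w) //=; congr (_ + _).
rewrite [LHS]big_mkcond [X in _ = X + _]big_mkcond [X in _ = _ + X]big_mkcond -big_split.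
apply: eq_bigr => u _ /=; rewrite finset.in_set.
have [->|uw] /= := eqVneq u w; first by rewrite adj_irrefl addr0.
by case: adj; rewrite ?addr0 ?add0r.
Qed.

Lemma neighbours_split (w u : G) (f : G -> R) : u != w -> \sum_(v | adj u v) f v =
  (adj w u)%:R * f w + (\sum_(v | adj w v && adj u v) f v
                       + \sum_(t in nonneighbours w | adj u t) f t).
Proof.
move=> uw; rewrite [LHS]big_mkcond (hub_split w) adj_sym; congr (_ + (_ + _)).
- by case: adj; rewrite ?mul1r ?mul0r.
- by rewrite -big_mkcondr.
- by rewrite -big_mkcondr.
Qed.

Section Nonneighbours.
Variables (c : R) (z : G -> R) (w : G).
Hypothesis zP : eigenpair c z w.
Local Notation k := `|c|.

Local Notation B := (nonneighbours w).

Let M := \big[Num.max/0]_(u | u != w) `|z u|.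
Let SB := \sum_(u in B) `|z u|.

Let M0 : 0 <= M. Proof. exact: bigmax_ge_id. Qed.

Let zM u : u != w -> `|z u| <= M. Proof. by move=> uw; exact: le_bigmax_cond. Qed.

(* The neighbours of [u] are possibly [w], at most two neighbours of [w], and
   nonneighbours of [w]. *)
Let neighbours_bound u : u != w -> k * `|z u| <=
  (adj w u)%:R + M *+ 2 + \sum_(t in B | adj u t) `|z t|.
Proof.
move=> uw; case: zP => zw z1 zA; rewrite -normrM -zA (le_trans (ler_norm_sum _ _ _)) //.
rewrite (neighbours_split _ uw) zw normr1 mulr1.
rewrite -addrA lerD2l lerD2r (@le_trans _ _ (\sum_(v | adj w v && adj u v) M)) //.
  by apply: ler_sum => v /andP[wv _]; apply: zM; apply: contraTneq wv => ->; rewrite adj_irrefl.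
by rewrite sum_count -[leRHS]mulr_natl ler_wpM2r // ler_nat (common_neighbours outerG) // eq_sym.
Qed.

(** Sum [neighbours_bound] over the nonneighbours, where the hub term is absent; 6 is 2 from common
    neighbours with the hub plus 4 from [sum_degrees_in]. *)
Let SB_bound : k * SB <= 6 * #|B|%:R * M.
Proof.
rewrite /SB mulr_sumr.
apply: (@le_trans _ _ (\sum_(u in B) (M *+ 2 + \sum_(t in B | adj u t) M))).
  apply: ler_sum => u; rewrite finset.in_set => /andP[uw wu].
  rewrite (le_trans (neighbours_bound uw)) // (negbTE wu) add0r lerD2l.
  apply: ler_sum => t /andP[]; rewrite finset.in_set => /andP[tw _] _; exact: zM.
rewrite big_split /= sumr_const -[_ *+ #|_|]mulr_natl.
have -> : \sum_(u in B) \sum_(t in B | adj u t) M =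
    (\sum_(u in B) \sum_(t in B | adj u t) 1) * M.
  rewrite mulr_suml; apply: eq_bigr => u _; rewrite mulr_suml.
  by under [RHS]eq_bigr do rewrite mul1r.
have := ler_wpM2r M0 (sum_degrees_in B); lra.
Qed.

(** Bootstrapping: [SB <= 240 M] by [SB_bound], so the maximum [M] off the hub satisfies
    [k M <= 1 + 242 M] and is at most [2 / s]. At a nonneighbour the hub term 1 is missing, which
    gains another factor [s]. *)
Lemma nonneighbour_small (s : R) : 1000 <= s -> s - 5 <= k -> #|B|%:R <= 20 * s ->
  forall v, v \in B -> `|z v| * s ^+ 2 <= 968.
Proof.
move=> s1 ks Bs v vB.
have SB0 : 0 <= SB by apply: sumr_ge0.
have SBM : SB <= 240 * M.
  rewrite -(@ler_pM2l _ k); last by lra.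
  apply: le_trans SB_bound _; apply: (@le_trans _ _ (120 * s * M)).
    by rewrite ler_wpM2r //; lra.
  rewrite mulrA ler_wpM2r //; lra.
have sub u : \sum_(t in B | adj u t) `|z t| <= SB.
  by rewrite /SB big_mkcondr ler_sum // => t _; case: ifP.
have k0 : 0 < k by lra.
have bound u : u != w -> k * `|z u| <= (adj w u)%:R + 242 * M.
  by move=> /neighbours_bound; have := sub u; rewrite mulr2n; lra.
have kM : k * M <= 1 + 242 * M.
  rewrite mulrC -ler_pdivlMr //; apply/bigmax_leP; split=> [|u uw].
    by rewrite divr_ge0 ?addr_ge0 ?mulr_ge0.
  rewrite ler_pdivlMr // mulrC (le_trans (bound u uw)) // lerD2r.
  by case: adj.
have sM : s * M <= 2.
  have H : s / 2 <= k - 242 by lra.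
  by have := ler_wpM2r M0 H; lra.
move: vB; rewrite finset.in_set => /andP[/bound + /negbTE wv]; rewrite {}wv add0r => kv.
have s0 : 0 < s by lra.
have H : s / 2 * `|z v| <= 242 * M.
  by apply: le_trans kv; rewrite ler_wpM2r //; lra.
have := ler_wpM2l (ltW s0) H; rewrite expr2; lra.
Qed.
End Nonneighbours.
End Eigenpair.

(** * Joining the hub to all vertices *)

Section HubGraph.
Variables (R : realType) (G : sgraph) (w : G).

(** The nonneighbours of [w] lose their edges and become pendant at [w], which keeps the graph
    outerplanar. *)
Definition hub_adj : rel G := fun u v =>
  (u != v) && [|| u == w, v == w | [&& adj w u, adj w v & adj u v]].

Fact hub_adj_sym : symmetric hub_adj.
Proof.
by move=> u v; rewrite /hub_adj eq_sym (adj_sym u v) orbCA andbCA.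
Qed.

Fact hub_adj_irrefl : irreflexive hub_adj.
Proof. by move=> u; rewrite /hub_adj eqxx. Qed.

Definition hub_graph : sgraph := SGraph hub_adj_sym hub_adj_irrefl.

Hypothesis outerG : outerplanar R G.

Lemma hub_graph_outerplanar : outerplanar R hub_graph.
Proof.
have [|ss [us sS ne con]] := @path_partition R G outerG w [set v | adj w v]%SET.
  by move=> v; rewrite finset.in_set.
(* The paths come first, one after the other; [enum G] is appended so that every vertex has a
   position. *)
pose l := flatten ss ++ enum G.
apply: (@fan_outerplanar R hub_graph w (fun v => index v l)).
  have mem_l v : v \in l by rewrite mem_cat mem_enum orbT.
  by move=> u v _ _; apply: index_inj (mem_l u) (mem_l v).
move=> u v /= /andP[_] /or3P[->//|->//|/and3P[wu wv uv]] _ _.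
have := con u v; rewrite !finset.in_set wu wv uv => /(_ isT isT) /esym.
move=> /(consecutive_flatten us) /and3P[ul vl].
by rewrite /l !index_cat ul vl => /orP[] /eqP; [left|right].
Qed.

Variables (c : R) (z : G -> R).
Hypothesis zP : eigenpair c z w.
Hypothesis c0 : c != 0.
Local Notation B := (nonneighbours w).

(* With the value [1 / c] at the nonneighbours of [w], the eigenvalue equation for [c]
   holds there exactly in the hub graph. *)
Let y v := if v \in B then c^-1 else z v.

(** The residual of the test vector: the added edges show up at the hub and the deleted ones at its
    neighbours. *)
Let hub_row (u : G) : \sum_(v | hub_adj u v) y v - c * y u =
  if u == w then #|B|%:R / c else
  if adj w u then - \sum_(t in B | adj u t) z t else 0.
Proof.
case: zP => zw z1 zA.
have yA v : adj w v -> y v = z v by rewrite /y finset.in_set => ->; rewrite andbF.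
have yw : y w = 1 by rewrite /y finset.in_set eqxx zw.
have yB v : v \in B -> y v = c^-1 by rewrite /y => ->.
have [->|uw] := eqVneq u w.
  rewrite yw mulr1 big_mkcond (hub_split w) /= /hub_adj eqxx /= add0r.
  have neq v : adj w v -> w != v by apply: contraTneq => <-; rewrite adj_irrefl.
  rewrite (eq_bigr z) => [|v wv]; last by rewrite neq // yA.
  rewrite zA zw mulr1 addrC addKr (eq_bigr (fun=> c^-1)) ?sumr_const ?mulr_natl //.
  by move=> v vB; rewrite yB //; move: vB; rewrite finset.in_set eq_sym => /andP[->].
have [wu|nwu] := boolP (adj w u).
  rewrite big_mkcond (hub_split w) /= /hub_adj uw eqxx (negbTE uw) orbT /= yw wu /=.
  rewrite (yA u wu) -zA (neighbours_split _ uw) wu zw mulr1.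
  have -> : \sum_(v in B) (if (u != v) && [|| v == w | adj w v && adj u v] then y v else 0) = 0.
    apply: big1 => v; rewrite finset.in_set => /andP[/negbTE -> /negbTE ->].
    by rewrite andbF.
  have -> : \sum_(v | adj w v)
     (if (u != v) && [|| v == w | adj w v && adj u v] then y v else 0) =
     \sum_(v | adj w v && adj u v) z v.
    rewrite big_mkcondr; apply: eq_bigr => v wv; rewrite wv yA //=.
    have [->|_] /= := eqVneq v w; last first.
      by have [->|] := eqVneq u v; rewrite ?adj_irrefl.
    by rewrite andbT uw; case: ifP => // /negbT; rewrite adj_sym wu.
  by rewrite /= addr0; ring.
have uB : u \in B by rewrite finset.in_set uw.
rewrite yB // divff // (big_pred1 w) ?yw ?subrr // => v /=.
rewrite /hub_adj (negbTE uw) (negbTE nwu) /= orbF.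
by have [->|_] := eqVneq v w; rewrite ?andbF // uw.
Qed.

(** The new edges gain [#|B| / c], while the loss is quadratic in the entries at nonneighbours,
    which are at most [b]. Multiplying by [c] treats the largest and the smallest eigenvalue at
    once. *)
Lemma hub_form (b : R) : B != finset.set0 -> (forall v, v \in B -> `|z v| <= b) ->
    b ^+ 2 * (c ^+ 2 + 4 * `|c|) < 1 ->
  exists x : G -> R, 0 < \sum_u x u ^+ 2 /\
    c ^+ 2 * \sum_u x u ^+ 2 < c * \sum_u \sum_(v | hub_adj u v) x u * x v.
Proof.
move=> B0 zb small; exists y; case: (zP) => zw z1 zA.
have yw : y w = 1 by rewrite /y finset.in_set eqxx zw.
split; first by apply: (@norm2_gt0 _ G _ w); rewrite yw oner_eq0.
have E : \sum_u \sum_(v | hub_adj u v) y u * y v - c * \sum_u y u ^+ 2 =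
    #|B|%:R / c - \sum_(t in B) z t * (c * z t - \sum_(v in B | adj t v) z v).
  rewrite mulr_sumr -sumrB.
  rewrite (eq_bigr (fun u => y u * (\sum_(v | hub_adj u v) y v - c * y u))); last first.
    by move=> u _; rewrite mulrBr mulr_sumr; ring.
  under eq_bigr do rewrite hub_row.
  rewrite (hub_split w) eqxx yw mul1r; congr (_ + _).
  rewrite [X in _ + X]big1 ?addr0 => [|u]; last first.
    by rewrite finset.in_set => /andP[/negbTE -> /negbTE ->]; rewrite mulr0.
  rewrite (eq_bigr (fun u => - \sum_(t in B | adj u t) z u * z t)) => [|u wu]; last first.
    have uw : (u == w) = false by apply/negbTE; apply: contraTneq wu => ->; rewrite adj_irrefl.
    by rewrite uw wu /y finset.in_set wu andbF mulrN mulr_sumr.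
  rewrite sumrN; congr (- _).
  (* The deleted edges to neighbours of the hub are counted from their ends in [B], where the
     eigenvalue equation of [z] evaluates the inner sum. *)
  rewrite (exchange_big_dep (fun t => t \in B)) /= => [|u t _ /andP[]//].
  apply: eq_bigr => t tB.
  have /andP[tw wt] : (t != w) && ~~ adj w t by move: tB; rewrite finset.in_set.
  rewrite -zA (neighbours_split _ tw) (negbTE wt) mul0r add0r addrK mulr_sumr.
  apply: eq_big => [u|u _]; last by rewrite mulrC.
  by rewrite tB (adj_sym u t).
have b0 : 0 <= b.
  by case/set0Pn: B0 => v /zb; apply: le_trans.
have Bgt0 : (0 < #|B|)%N by rewrite card_gt0.
rewrite -subr_gt0 expr2 -mulrA -mulrBr E mulrBr mulrCA divff // mulr1 mulr_sumr.
have bound t : t \in B -> c * (z t * (c * z t - \sum_(v in B | adj t v) z v)) <=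
    c ^+ 2 * b ^+ 2 + `|c| * b ^+ 2 * \sum_(v in B | adj t v) 1.
  move=> tB; rewrite mulrBr mulrBr lerD //.
    have -> : c * (z t * (c * z t)) = c ^+ 2 * z t ^+ 2 by ring.
    rewrite ler_wpM2l ?sqr_ge0 //; by rewrite -real_normK ?num_real // lerXn2r ?nnegrE ?zb.
  have S1 : `|\sum_(v in B | adj t v) z v| <= b * \sum_(v in B | adj t v) 1.
    rewrite (le_trans (ler_norm_sum _ _ _)) // mulr_sumr.
    by apply: ler_sum => v /andP[vB _]; rewrite mulr1 zb.
  rewrite -mulrN (le_trans (ler_norm _)) // !normrM normrN normrM.
  by rewrite expr2 -!mulrA ler_wpM2l // ler_pM // zb.
rewrite subr_gt0; apply: le_lt_trans (ler_sum _ bound) _.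
rewrite big_split /= sumr_const -mulr_sumr -[_ *+ #|_|]mulr_natl.
have B1 : 0 < #|B|%:R :> R by rewrite ltr0n.
have cb : 0 <= `|c| * b ^+ 2 by rewrite mulr_ge0 ?sqr_ge0.
have := ler_wpM2l cb (sum_degrees_in outerG B); rewrite -(ltr_pM2l B1) in small; lra.
Qed.

End HubGraph.

(** * Eigenvalues when the hub is adjacent to all other vertices *)

Section Dominated.
Variables (R : realType) (G : sgraph) (w : G).
Hypothesis outerG : outerplanar R G.
Hypothesis dom : forall u, u != w -> adj w u.

Definition link_degree (w u : G) := #|[set v | adj w v && adj u v]%SET|.

Let D : R := \sum_(u | adj w u) (link_degree w u)%:R.

(** Off the hub [c z u = 1 + T u]. Substituting this twice into the equation at the hub gives the
    cubic with error [\sum d v * T v], and [T] is at most [2 M] with [M (|c| - 2) <= 1]. *)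
Lemma eigenvalue_dominated (c : R) z : eigenpair c z w -> 2 < `|c| ->
  `|c ^+ 3 - (degree w)%:R * c - D| * (`|c| - 2) <= 2 * D.
Proof.
case=> zw z1 zA c2; pose T u := \sum_(v | adj w v && adj u v) z v.
have noB : nonneighbours w = finset.set0.
  apply/setP => v; rewrite !finset.in_set; apply/negP => /andP[/dom -> //].
have neq u : adj w u -> u != w by apply: contraTneq => ->; rewrite adj_irrefl.
have zT u : adj w u -> c * z u = 1 + T u.
  move=> wu; rewrite -zA (neighbours_split _ (neq u wu)) wu zw noB mulr1.
  by rewrite [X in _ + (_ + X)]big1 ?addr0 // => v; rewrite finset.in_set0.
pose d u : R := (link_degree w u)%:R.
have d0 u : 0 <= d u by exact: ler0n.
have d2 u : adj w u -> d u <= 2.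
  by move=> wu; rewrite (ler_nat R _ 2) (common_neighbours outerG) // eq_sym neq.
have c_sq : c ^+ 2 = (degree w)%:R + \sum_(v | adj w v) d v * z v.
  have c1 : c = \sum_(u | adj w u) z u by rewrite zA zw mulr1.
  rewrite expr2 {2}c1 mulr_sumr (eq_bigr (fun u => 1 + T u)) //.
  rewrite big_split /= (degree_sum R); congr (_ + _).
  rewrite /T (exchange_big_dep (fun v => adj w v)) /= => [|u v _ /andP[]//].
  apply: eq_bigr => v wv; rewrite sum_count; congr (_%:R * _).
  by apply: eq_card => u; rewrite !finset.in_set wv (adj_sym u v).
have c_cube : c ^+ 3 - (degree w)%:R * c - D = \sum_(v | adj w v) d v * T v.
  transitivity (c * (\sum_(v | adj w v) d v * z v) - D); first by rewrite exprS c_sq; ring.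
  rewrite mulr_sumr /D -sumrB.
  by apply: eq_bigr => v wv; rewrite mulrCA zT //; rewrite /d; ring.
pose M := \big[Num.max/0]_(u | adj w u) `|z u|.
have zM u : adj w u -> `|z u| <= M by move=> wu; exact: le_bigmax_cond.
have M0 : 0 <= M by exact: bigmax_ge_id.
have TM u : `|T u| <= d u * M.
  rewrite (le_trans (ler_norm_sum _ _ _)) // -sum_count.
  by apply: ler_sum => v /andP[wv _]; exact: zM.
have kM : M * (`|c| - 2) <= 1.
  suff : M <= (1 + 2 * M) / `|c|.
    by rewrite ler_pdivlMr; [lra|rewrite (lt_trans _ c2)].
  apply/bigmax_leP; split=> [|u wu]; first by rewrite divr_ge0 ?addr_ge0 ?mulr_ge0.
  rewrite ler_pdivlMr; last by rewrite (lt_trans _ c2).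
  rewrite mulrC -normrM zT // (le_trans (ler_normD _ _)) // normr1 lerD2l.
  by rewrite (le_trans (TM u)) // ler_wpM2r // d2.
have sumT : `|\sum_(v | adj w v) d v * T v| <= 2 * M * D.
  rewrite (le_trans (ler_norm_sum _ _ _)) // mulr_sumr; apply: ler_sum => v wv.
  rewrite normrM ger0_norm // mulrC ler_wpM2r // (le_trans (TM v)) //.
  by rewrite ler_wpM2r // d2.
have D0 : 0 <= D by apply: sumr_ge0 => u _; exact: ler0n.
rewrite c_cube; apply: (@le_trans _ _ (2 * M * D * (`|c| - 2))).
  by rewrite ler_wpM2r // subr_ge0 ltW.
by have := ler_wpM2l D0 kM; lra.
Qed.
End Dominated.

(** * Numerical inequalities *)

Section Estimates.
Variable R : realType.
Implicit Types s l n d D : R.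

(** A violation would make [l (l^2 - d)] or [n (n^2 - d')] at least about [10 s^2], above the slack
    [8 (s^2 + 1)]. *)
Lemma eigenvalue_estimates s l n d d' : 1000 <= s -> n <= l -> s *+ 2 <= l + n ->
    l ^+ 3 <= l * d + 8 * (s ^+ 2 + 1) -> n ^+ 3 <= n * d' + 8 * (s ^+ 2 + 1) ->
    d <= s ^+ 2 -> d' <= s ^+ 2 ->
  [/\ s <= l, l <= s + 5, s - 5 <= n, s ^+ 2 - 20 * s <= d & s ^+ 2 - 20 * s <= d'].
Proof.
move=> s1 nl ln ld nd ds ds'.
have ls : s <= l by lra.
have l5 : l <= s + 5.
  rewrite leNgt; apply/negP => l5.
  have : l * (s * 10) <= l * (l ^+ 2 - s ^+ 2) by rewrite ler_wpM2l; nra.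
  nra.
have n5 : s - 5 <= n by lra.
split=> //.
  rewrite leNgt; apply/negP => H.
  have : l * (s * 20) <= l * (l ^+ 2 - d) by rewrite ler_wpM2l; nra.
  nra.
rewrite leNgt; apply/negP => H.
have : n * (s * 10) <= n * (n ^+ 2 - d') by rewrite ler_wpM2l; nra.
nra.
Qed.

(** The left side is at most [1.02 (b s)^2], and [b s = 968 / s] is at most 0.968. *)
Lemma nonneighbour_estimate s b c : 1000 <= s -> b * s ^+ 2 = 968 ->
  0 <= b -> 0 <= c -> c <= s + 5 -> b ^+ 2 * (c ^+ 2 + 4 * c) < 1.
Proof.
move=> s1 bs b0 c0 cs; have s0 : 0 < s by lra.
have bs1 : b * s <= 968 / 1000.
  have bss : b * s * s = 968 by rewrite -mulrA -expr2.
  rewrite -(ler_pM2r s0) bss.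
  lra.
have c2 : c ^+ 2 + 4 * c <= s ^+ 2 * (102 / 100) by nra.
have := ler_wpM2l (sqr_ge0 b) c2; rewrite mulrA -exprMn.
have : 0 <= b * s by rewrite mulr_ge0 // ltW.
move: bs1; set x := b * s => bs1 x0.
by have := ler_pM x0 x0 bs1 bs1; lra.
Qed.

(** To first order [D] raises both eigenvalues [l] and [- n] equally and cancels in the spread. What
    remains is [l^2 + n^2 <= 2 s^2 + 2 e / n] with [e / n] at most [4 D / s^2], against
    [(l + n)^2 >= 4 s^2 + 1]. *)
Lemma link_degree_estimate s l n D : 1000 <= s -> n <= l -> s - 5 <= n -> 0 <= D ->
    2 * s + (4 * s)^-1 <= l + n ->
    `|l ^+ 3 - s ^+ 2 * l - D| * (l - 2) <= 2 * D ->
    `|(- n) ^+ 3 - s ^+ 2 * (- n) - D| * (n - 2) <= 2 * D ->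
  s ^+ 2 <= 16 * D.
Proof.
move=> s1 nl n5 D0 ln Hl Hn.
have s0 : 0 < s by lra.
have n0 : 0 < n by lra.
have l0 : 0 < l by lra.
pose e := 2 * D / (n - 2).
have e0 : 0 <= e by rewrite divr_ge0 //; lra.
have en : e * (n - 2) = 2 * D by rewrite /e mulfVK //; lra.
have l3 : l ^+ 3 <= s ^+ 2 * l + D + e.
  have : l ^+ 3 - s ^+ 2 * l - D <= e.
    rewrite (le_trans (ler_norm _)) // /e ler_pdivlMr; last by lra.
    by rewrite (le_trans _ Hl) // ler_wpM2l //; lra.
  lra.
have n3 : n ^+ 3 <= s ^+ 2 * n - D + e.
  have : - ((- n) ^+ 3 - s ^+ 2 * (- n) - D) <= e.
    rewrite (le_trans (ler_norm _)) // normrN /e ler_pdivlMr //; lra.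
  have -> : (- n) ^+ 3 = - n ^+ 3 by ring.
  lra.
(* Dividing by [n] instead of [l] is weaker, as [n <= l], but lets the [D] terms cancel against
   those of [n2]. *)
have l2 : l ^+ 2 <= s ^+ 2 + (D + e) / n.
  rewrite -lerBlDl ler_pdivlMr //.
  have : (l ^+ 2 - s ^+ 2) * l <= D + e by rewrite mulrBl -exprSr; lra.
  have [neg _|pos] := leP (l ^+ 2 - s ^+ 2) 0.
    by have := mulr_le0_ge0 neg (ltW n0); lra.
  by apply: le_trans; rewrite ler_wpM2l // ltW.
have n2 : n ^+ 2 <= s ^+ 2 + (e - D) / n.
  by rewrite -lerBlDl ler_pdivlMr // mulrBl -exprSr; lra.
have en2 : e / n * s ^+ 2 <= 4 * D.
  rewrite mulrAC ler_pdivrMr //.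
  have : s ^+ 2 <= 2 * n * (n - 2) by nra.
  move=> /(ler_wpM2l e0); have -> : e * (2 * n * (n - 2)) = 2 * n * (e * (n - 2)) by ring.
  by rewrite en; lra.
have sum2 : l ^+ 2 + n ^+ 2 <= 2 * s ^+ 2 + 2 * (e / n).
  by move: l2 n2; rewrite mulrDl mulrBl; lra.
have lo : 4 * s ^+ 2 + 1 <= (l + n) ^+ 2.
  have h : 0 < (4 * s)^-1 by rewrite invr_gt0; lra.
  have hs : (4 * s)^-1 * s = 4^-1 by field; rewrite gt_eqF.
  have : (2 * s + (4 * s)^-1) ^+ 2 <= (l + n) ^+ 2.
    by rewrite lerXn2r // nnegrE; lra.
  apply: le_trans; move: h hs; set q := (4 * s)^-1; nra.
have up2 : (l + n) ^+ 2 <= 2 * (l ^+ 2 + n ^+ 2) by nra.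
have one : 1 <= 4 * (e / n) by lra.
have := ler_wpM2r (sqr_ge0 s) one; lra.
Qed.

(** Both eigenvalues shift by about [m / s^2], nearly one third. In the cubics the second-order
    gain, at least [(3/10) s], pays for the cost [s / 4] of the extra [e]. *)
Lemma comparison_estimate s m : 100 <= s -> m * 3 <= s ^+ 2 -> s ^+ 2 <= m * 3 + 2 ->
  exists l n, [/\ 1 < l, 0 < n, 2 * s + (4 * s)^-1 <= l + n,
    l ^+ 3 - l ^+ 2 <= s ^+ 2 * l - s ^+ 2 + 2 * m &
    n ^+ 3 + n ^+ 2 <= s ^+ 2 * n + s ^+ 2 - 2 * m].
Proof.
move=> s1 m1 m2; have s0 : 0 < s by lra.
pose e := (8 * s)^-1; have e0 : 0 < e by rewrite invr_gt0; lra.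
have es : e * s = 8^-1 by rewrite /e; field; rewrite gt_eqF.
have e1 : e <= 100^-1 by nra.
exists (s + 3^-1 + e), (s - 3^-1 + e); split; try lra.
- rewrite (_ : (4 * s)^-1 = e + e); last by rewrite /e; field; rewrite gt_eqF.
  lra.
- set t := 3^-1 + e.
  have -> : s + 3^-1 + e = s + t by rewrite /t; ring.
  have id : s ^+ 2 * (s + t) - s ^+ 2 + 2 * m - ((s + t) ^+ 3 - (s + t) ^+ 2) =
    (2 * m - 2 / 3 * s ^+ 2) - 2 * (e * s) * s - s * (3 * t ^+ 2 - 2 * t) - t ^+ 3 + t ^+ 2
    by rewrite /t; field.
  have : 3 * t ^+ 2 - 2 * t <= - (3 / 10) by rewrite /t; nra.
  move=> /(ler_wpM2l (ltW s0)) h1.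
  have t3 : t ^+ 3 <= 1 by rewrite /t; nra.
  rewrite -subr_ge0 id es; have := sqr_ge0 t; lra.
- set t := e - 3^-1.
  have -> : s - 3^-1 + e = s + t by rewrite /t; ring.
  have id : s ^+ 2 * (s + t) + s ^+ 2 - 2 * m - ((s + t) ^+ 3 + (s + t) ^+ 2) =
    (2 / 3 * s ^+ 2 - 2 * m) - 2 * (e * s) * s - s * (3 * t ^+ 2 + 2 * t) - t ^+ 3 - t ^+ 2
    by rewrite /t; field.
  have : 3 * t ^+ 2 + 2 * t <= - (3 / 10) by rewrite /t; nra.
  move=> /(ler_wpM2l (ltW s0)) h1.
  have t32 : t ^+ 3 + t ^+ 2 <= 1 by rewrite /t; nra.
  rewrite -subr_ge0 id es; lra.
Qed.
End Estimates.

(** * A comparison graph *)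

Section Matching.
Variables m r : nat.

Definition matching_adj : rel ('I_m * bool + 'I_r)%type := fun u v =>
  match u, v with
  | inl a, inl b => (a.1 == b.1) && (a.2 != b.2)
  | _, _ => false
  end.

Fact matching_adj_sym : symmetric matching_adj.
Proof. by move=> [[i b]|i] [[j c]|j] //=; rewrite eq_sym (eq_sym b). Qed.

Fact matching_adj_irrefl : irreflexive matching_adj.
Proof. by move=> [[i b]|i] //=; rewrite !eqxx. Qed.

Definition matching : sgraph := SGraph matching_adj_sym matching_adj_irrefl.

Lemma card_join_matching : #|join K1 matching| = (m * 2 + r).+1.
Proof. by rewrite card_sum card_unit card_sum card_prod !card_ord card_bool. Qed.

Lemma join_matching_outerplanar (R : realType) : outerplanar R (join K1 matching).
Proof.
pose pos (v : join K1 matching) := match v with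
  | inl _ => 0%N
  | inr (inl a) => (a.1 * 2 + a.2)%N
  | inr (inr j) => (m * 2 + j)%N
  end.
apply: (@fan_outerplanar R (join K1 matching) (inl tt) pos).
- move=> [[]|[[i b]|i]] [[]|[[j c]|j]] //= _ _ E.
  + have ij : i = j by apply: ord_inj; move: E; case: b; case: c => /=; lia.
    by subst j; move: E; case: b; case: c => //= /eqP; lia.
  + by have := ltn_ord i; move: E; case: b => /=; lia.
  + by have := ltn_ord j; move: E; case: c => /=; lia.
  + by congr (inr (inr _)); apply: ord_inj; lia.
- move=> [[]|[[i b]|i]] [[]|[[j c]|j]] //= /andP[/eqP -> bc] _ _.
  by case: b c bc => [] [] //= _; [right|left]; lia.
Qed.

Section Spread.
Variable R : realType.

Let vec (p q : R) (v : join K1 matching) : R := match v with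
  | inl _ => 1
  | inr (inl _) => p
  | inr (inr _) => q
  end.

Let sum_join (f : join K1 matching -> R) : \sum_u f u =
  f (inl tt) + (\sum_a f (inr (inl a)) + \sum_j f (inr (inr j))).
Proof.
rewrite big_sumType /= big_sumType /=; congr (_ + _).
by rewrite (big_pred1 tt) // => -[].
Qed.

Let sum_const_prod (x : R) : \sum_(a : 'I_m * bool) x = m%:R * 2 * x.
Proof. by rewrite sumr_const card_prod card_ord card_bool -[LHS]mulr_natl natrM. Qed.

Let sum_const_ord (x : R) : \sum_(j < r) x = r%:R * x.
Proof. by rewrite sumr_const card_ord -[LHS]mulr_natl. Qed.

Let vec_row p q u : \sum_(v | @adj (join K1 matching) u v) vec p q v =
  match u with
  | inl _ => m%:R * 2 * p + r%:R * q
  | inr (inl _) => 1 + p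
  | inr (inr _) => 1
  end.
Proof.
rewrite big_mkcond sum_join; case: u => [[]|[[i b]|i]] /=.
- by rewrite add0r sum_const_prod sum_const_ord.
- rewrite [X in _ + (_ + X)]big1 // addr0; congr (_ + _).
  rewrite -big_mkcond (big_pred1 (i, ~~ b)) // => -[j c] /=.
  rewrite xpair_eqE (eq_sym i); case: (j == i) => //=.
  by case: b; case: c.
- by rewrite big1 // add0r big1 // addr0.
Qed.

(** A Rayleigh bound with a vector constant on the hub, the matched and the isolated vertices; the
    residual at the hub, cleared of denominators, is the assumed cubic inequality. *)
Lemma join_matching_sup (t : R) : 1 < t ->
    t ^+ 3 - t ^+ 2 <= (m * 2 + r)%:R * t - (m * 2 + r)%:R + 2 * m%:R ->
  t <= sup (@spectrum R (join K1 matching)).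
Proof.
move=> t1 H; have [_ [_ _ max]] := spectrum_max R (inl tt : join K1 matching).
(* For these values the eigenvalue equation for [t] holds outside the hub. *)
pose p := (t - 1)^-1; pose q := t^-1.
have N0 : 0 < \sum_u vec p q u ^+ 2.
  by apply: (@norm2_gt0 R (join K1 matching) (vec p q) (inl tt)); exact: oner_neq0.
rewrite -(ler_pM2r N0); apply: le_trans (max (vec p q)).
under [X in _ <= X]eq_bigr do rewrite -mulr_sumr vec_row.
rewrite !sum_join /= !sum_const_prod !sum_const_ord -subr_ge0.
have tp : (t - 1) * p = 1 by rewrite /p divff //; lra.
have tq : t * q = 1 by rewrite /q divff //; lra.
rewrite [X in 0 <= X](_ : _ = m%:R * 2 * p + r%:R * q - t
  + m%:R * 2 * p * (1 - (t - 1) * p) + r%:R * q * (1 - t * q)); last by ring.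
rewrite tp tq !subrr !mulr0 !addr0.
have p0 : 0 < p by rewrite invr_gt0; lra.
have q0 : 0 < q by rewrite invr_gt0; lra.
have -> : m%:R * 2 * p + r%:R * q - t =
    p * q * (m%:R * 2 * t + r%:R * (t - 1) - (t ^+ 3 - t ^+ 2)).
  by rewrite /p /q; field; apply/andP; split; lra.
rewrite mulr_ge0 ?mulr_ge0 ?(ltW p0) ?(ltW q0) //.
by move: H; rewrite natrD natrM; lra.
Qed.

Lemma join_matching_inf (t : R) : 0 < t ->
    t ^+ 3 + t ^+ 2 <= (m * 2 + r)%:R * t + (m * 2 + r)%:R - 2 * m%:R ->
  inf (@spectrum R (join K1 matching)) <= - t.
Proof.
move=> t1 H; have [_ [_ _ min]] := spectrum_min R (inl tt : join K1 matching).
(* With the entries [- p] and [- q] the eigenvalue equation for [- t] holds outside the hub. *)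
pose p := (t + 1)^-1; pose q := t^-1.
have N0 : 0 < \sum_u vec (- p) (- q) u ^+ 2.
  by apply: (@norm2_gt0 R (join K1 matching) (vec (- p) (- q)) (inl tt)); exact: oner_neq0.
rewrite -(ler_pM2r N0); apply: le_trans (min (vec (- p) (- q))) _.
under [X in X <= _]eq_bigr do rewrite -mulr_sumr vec_row.
rewrite !sum_join /= !sum_const_prod !sum_const_ord -subr_ge0.
have tp : (t + 1) * p = 1 by rewrite /p divff //; lra.
have tq : t * q = 1 by rewrite /q divff //; lra.
rewrite [X in 0 <= X](_ : _ = m%:R * 2 * p + r%:R * q - t
  + m%:R * 2 * p * (1 - (t + 1) * p) + r%:R * q * (1 - t * q)); last by ring.
rewrite tp tq !subrr !mulr0 !addr0.
have p0 : 0 < p by rewrite invr_gt0; lra.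
have q0 : 0 < q by rewrite invr_gt0; lra.
have -> : m%:R * 2 * p + r%:R * q - t =
    p * q * (m%:R * 2 * t + r%:R * (t + 1) - (t ^+ 3 + t ^+ 2)).
  by rewrite /p /q; field; apply/andP; split; lra.
rewrite mulr_ge0 ?mulr_ge0 ?(ltW p0) ?(ltW q0) //.
by move: H; rewrite natrD natrM; lra.
Qed.
End Spread.
End Matching.

Lemma comparison_graph (R : realType) (N : nat) : 100 <= Num.sqrt N%:R :> R ->
  exists H : sgraph, [/\ #|H| = N.+1, outerplanar R H &
    2 * Num.sqrt N%:R + (4 * Num.sqrt N%:R)^-1 <= spread R H].
Proof.
set s := Num.sqrt _ => s1; have s2 : s ^+ 2 = N%:R by rewrite sqr_sqrtr.
(* For [m = x s^2] the second-order gain is proportional to [2 x - 3 x^2], which is largest at one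
   third. *)
pose m := (N %/ 3)%N; pose r := (N - m * 2)%N.
have Nm : (m * 2 + r)%N = N by rewrite /r /m; lia.
have [||l [n [l1 n0 ln Hl Hn]]] := @comparison_estimate R s m%:R s1.
- by rewrite s2 -natrM ler_nat /m; lia.
- by rewrite s2 -natrM -natrD ler_nat /m; lia.
exists (join K1 (matching m r)); split; [by rewrite card_join_matching Nm| |].
  exact: join_matching_outerplanar.
have lsup := @join_matching_sup m r R l l1.
have ninf := @join_matching_inf m r R n n0.
rewrite Nm -s2 in lsup ninf; rewrite /spread.
have := lsup Hl; have := ninf Hn; lra.
Qed.

(** * Graphs of maximal spread *)

Lemma card_adj_le_edges (G : sgraph) :
  (#|[pred u : G * G | adj u.1 u.2]| <= 2 * #|edges G|)%N.
Proof.
pose f (u : G * G) := [set u.1; u.2]%SET.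
rewrite -[X in (X <= _)%N]sum1_card (partition_big f [in edges G]) /=; last first.
  by move=> u uA; apply/imsetP; exists u.
rewrite mulnC -sum_nat_const.
apply: leq_sum => _ /imsetP[[a b] _ ->]; rewrite sum1dep_card.
apply: leq_trans (_ : #|[set (a, b); (b, a)]%SET| <= 2)%N; last by rewrite cards2; case: eqP.
apply/subset_leq_card/fintype.subsetP => -[c d]; rewrite !finset.in_set !inE /=.
case/andP=> cd /eqP E; have {}E : [set c; d]%SET = [set a; b]%SET := E.
have ncd : c != d by apply: contraTneq cd => ->; rewrite adj_irrefl.
have : c \in [set a; b]%SET by rewrite -E set21.
have : d \in [set a; b]%SET by rewrite -E set22.
rewrite !finset.in_set2 !xpair_eqE => /orP[] /eqP dE /orP[] /eqP cE; subst c d.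
all: by rewrite ?eqxx ?orbT // eqxx in ncd *.
Qed.

(** * Deleting the hub *)

Section DeleteVertex.
Variables (G : sgraph) (w : G).

Definition delete_adj : rel {v : G | v != w} := fun u v => adj (val u) (val v).

Fact delete_adj_sym : symmetric delete_adj.
Proof. by move=> u v; exact: adj_sym. Qed.

Fact delete_adj_irrefl : irreflexive delete_adj.
Proof. by move=> u; exact: adj_irrefl. Qed.

Definition delete_vertex : sgraph := SGraph delete_adj_sym delete_adj_irrefl.

Lemma card_delete_vertex : #|delete_vertex| = (#|G| - 1)%N.
Proof. by rewrite card_sig cardC1 subn1. Qed.

Hypothesis dom : forall u, u != w -> adj w u.

Lemma join_delete_vertex : isomorphic G (join K1 delete_vertex).
Proof.
pose f v : join K1 delete_vertex :=
  if insub v is Some x then inr (x : {v : G | v != w}) else inl tt.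
pose g (u : join K1 delete_vertex) := match u with inl _ => w | inr x => val x end.
have fw : f w = inl tt by rewrite /f insubN // eqxx.
have fN v (vw : v != w) : f v = inr (Sub v vw) by rewrite /f insubT.
have gf : cancel f g.
  by move=> v; have [->|vw] := eqVneq v w; [rewrite fw|rewrite fN].
have fg : cancel g f.
  by case=> [[]|x] /=; rewrite ?fw // fN; [exact: (valP x)|move=> xw; congr inr; exact: val_inj].
exists f; first by exists g.
move=> x y; rewrite -{2}(gf x) -{2}(gf y).
case: (f x) => [[]|u]; case: (f y) => [[]|v] //=.
- by rewrite adj_irrefl.
- by rewrite dom // (valP v).
- by rewrite adj_sym dom // (valP u).
Qed.

Lemma delete_vertex_linear (R : realType) : outerplanar R G -> linear_forest delete_vertex.
Proof.
move=> outerG.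
have [|ss [us sS ne con]] := @path_partition R G outerG w [set v | adj w v]%SET.
  by move=> v; rewrite finset.in_set.
apply: (@linear_forest_of_partition _ delete_vertex val w ss) => //.
- move=> y; rewrite sS finset.in_set; apply: (iffP idP) => [wy|[x <-]].
    have yw : y != w by apply: contraTneq wy => ->; rewrite adj_irrefl.
    by exists (Sub y yw).
  exact/dom/(valP x).
- by move=> u v; rewrite -con // finset.in_set; apply/dom; [exact: (valP u)|exact: (valP v)].
Qed.

Lemma sum_link_degree :
  (\sum_(u | adj w u) link_degree w u <= 2 * #|edges delete_vertex|)%N.
Proof.
apply: leq_trans (card_adj_le_edges delete_vertex).
under eq_bigr do rewrite /link_degree -sum1dep_card.
rewrite pair_big_dep sum1dep_card /=.
pose f (p : delete_vertex * delete_vertex) := (val p.1, val p.2).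
apply: leq_trans (leq_image_card f _).
apply/subset_leq_card/fintype.subsetP => -[u v]; rewrite finset.in_set /=.
case/and3P=> wu wv uv.
have neq x : adj w x -> x != w by apply: contraTneq => ->; rewrite adj_irrefl.
by apply/fintype.imageP; exists (Sub u (neq u wu), Sub v (neq v wv)).
Qed.
End DeleteVertex.

Section MaximalSpread.
Variables (R : realType) (G : sgraph) (N : nat).
Hypothesis outerG : outerplanar R G.
Hypothesis cardG : #|G| = N.+1.
Hypothesis maxG : forall H : sgraph, #|H| = N.+1 -> outerplanar R H ->
  spread R H <= spread R G.
Variables (s l n : R).
Hypothesis sE : s = Num.sqrt N%:R.
Hypothesis s_large : 1000 <= s.
Hypothesis lE : l = sup (@spectrum R G).
Hypothesis nE : n = - inf (@spectrum R G).

Let s2 : s ^+ 2 = N%:R. Proof. by rewrite sE sqr_sqrtr. Qed.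

Let cardGR : #|G|%:R = s ^+ 2 + 1 :> R.
Proof. by rewrite cardG -natr1 s2. Qed.

Lemma degree_le (u : G) : (degree u)%:R <= s ^+ 2.
Proof.
have -> : s ^+ 2 = #|[set~ u]%SET|%:R by rewrite cardsC1 cardG s2.
rewrite ler_nat; apply/subset_leq_card/fintype.subsetP => v.
by rewrite finset.in_set finset.in_setC1; apply: contraTneq => ->; rewrite adj_irrefl.
Qed.

Lemma card_nonneighbours (w : G) :
  #|nonneighbours w|%:R = s ^+ 2 - (degree w)%:R :> R.
Proof.
have := hub_split w (fun=> 1 : R); rewrite -degree_sum !sumr_const cardGR.
lra.
Qed.

Lemma maximal_spread_ge : 2 * s + (4 * s)^-1 <= l + n.
Proof.
have [|H [cardH outerH]] := @comparison_graph R N; first by rewrite -sE; have := s_large; lra.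
rewrite -sE => /le_trans; apply; rewrite lE nE; exact: maxG.
Qed.

Lemma maximal_spread_structure : exists w : G, (forall u, u != w -> adj w u) /\
  s ^+ 2 <= 16 * \sum_(u | adj w u) (link_degree w u)%:R.
Proof.
have [g0 _] : exists g0 : G, g0 \in G by apply/card_gt0P; rewrite cardG.
have [? [x0 xA _]] := spectrum_max R g0.
have [? [y0 yA _]] := spectrum_min R g0.
have [w [x xP]] := eigenpair_of_eigenvector x0 xA.
have [w' [y yP]] := eigenpair_of_eigenvector y0 yA.
rewrite -lE in xP; rewrite -[inf _]opprK -nE in yP.
have nl : `|n| <= l by rewrite nE lE normrN; exact: norm_inf_spectrum_le.
have ln := maximal_spread_ge.
have s1 := s_large.
have s0 : 0 < s by lra.
have q0 : 0 < (4 * s)^-1 by rewrite invr_gt0; lra.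
have nn := ler_norm n.
have ln2 : 2 * s <= l + n by lra.
have nl2 : n <= l by exact: le_trans nn nl.
have l0 : 0 < l by lra.
(* The absolute value of [n] is used because the sign of [n] is known only after this estimate. *)
have [|||||ls l5 n5 dw dw'] := @eigenvalue_estimates R s l `|n| (degree w)%:R (degree w')%:R s1 nl.
all: try exact: degree_le; rewrite //.
- by rewrite mulr2n; lra.
- by rewrite -cardGR -{1 2}(gtr0_norm l0); exact: eigenvalue_degree xP.
- by rewrite -cardGR -normrN; exact: eigenvalue_degree yP.
have n0 : 0 < n by lra.
have normn : `|n| = n by rewrite gtr0_norm.
have norml : `|l| = l by rewrite gtr0_norm.
(* Both neighbourhoods miss only [O(s)] vertices, so two distinct hubs would have more than two
   common neighbours. *)
have ww' : w' = w.
  apply/eqP; apply: contraT => ne.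
  have := cardsUI [set v | adj w v]%SET [set v | adj w' v]%SET.
  have -> : ([set v | adj w v] :&: [set v | adj w' v])%SET = [set v | adj w v && adj w' v]%SET.
    by apply/setP => v; rewrite !finset.in_set.
  have c2 := common_neighbours outerG (a := w) (b := w'); rewrite eq_sym in ne.
  have {}c2 := c2 ne; set U := (_ :|: _)%SET => E.
  have Un : (#|U| <= #|G|)%N by exact: max_card.
  have : (degree w)%:R + (degree w')%:R <= (#|G| + 2)%:R :> R.
    by rewrite -natrD ler_nat /degree -E leq_add.
  by rewrite natrD cardGR; nra.
subst w'; exists w.
(* A nonneighbour would make the hub graph strictly better at both ends of the spectrum,
   contradicting maximality. *)
have dom u : u != w -> adj w u.
  move=> uw; apply: contraT => nwu.
  have B0 : nonneighbours w != finset.set0.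
    by apply/set0Pn; exists u; rewrite finset.in_set uw.
  have cB : #|nonneighbours w|%:R <= 20 * s by rewrite card_nonneighbours; lra.
  pose b := 968 / s ^+ 2.
  have s20 : 0 < s ^+ 2 by rewrite exprn_gt0.
  have zb c z : eigenpair c z w -> s - 5 <= `|c| ->
      forall v, v \in nonneighbours w -> `|z v| <= b.
    move=> zP cs v vB; rewrite ler_pdivlMr //.
    exact: (nonneighbour_small outerG zP s_large cs cB).
  have small c : `|c| <= s + 5 -> b ^+ 2 * (c ^+ 2 + 4 * `|c|) < 1.
    rewrite -(real_normK (num_real c)); apply: nonneighbour_estimate s1 _ _ (normr_ge0 c).
      by rewrite /b mulfVK ?gt_eqF.
    by apply: divr_ge0; [lra|exact: ltW].
  have outerH := hub_graph_outerplanar w outerG.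
  have [? [_ _ hmax]] := spectrum_max R (w : hub_graph w).
  have [? [_ _ hmin]] := spectrum_min R (w : hub_graph w).
  have {}hmax (p : G -> R) : \sum_(v : G) \sum_(t | hub_adj w v t) p v * p t <=
    sup (@spectrum R (hub_graph w)) * \sum_(v : G) p v ^+ 2 := hmax p.
  have {}hmin (p : G -> R) : inf (@spectrum R (hub_graph w)) * \sum_(v : G) p v ^+ 2 <=
    \sum_(v : G) \sum_(t | hub_adj w v t) p v * p t := hmin p.
  have lH : l < sup (@spectrum R (hub_graph w)).
    have c0 : l != 0 by rewrite gt_eqF.
    have lb := zb _ _ xP; rewrite norml in lb; have {}lb := lb ltac:(lra).
    have sm := small l; rewrite norml in sm; have {}sm := sm l5; rewrite -{2}norml in sm.
    have [p [p0]] := hub_form outerG xP c0 B0 lb sm.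
    rewrite expr2 -mulrA ltr_pM2l // => pl.
    by rewrite -(ltr_pM2r p0); exact: lt_le_trans (hmax p).
  have nH : inf (@spectrum R (hub_graph w)) < - n.
    have c0 : - n != 0 by rewrite oppr_eq0 gt_eqF.
    have lb := zb _ _ yP; rewrite normrN normn in lb; have {}lb := lb ltac:(lra).
    have sm := small (- n); rewrite normrN normn in sm; have {}sm := sm ltac:(lra).
    rewrite -{2}normn -normrN in sm.
    have [p [p0]] := hub_form outerG yP c0 B0 lb sm.
    (* Cancelling the negative factor [- n] reverses the inequality of [hub_form]. *)
    rewrite expr2 -mulrA ltr_nM2l ?oppr_lt0 // => pl.
    by rewrite -(ltr_pM2r p0); exact: le_lt_trans pl.
  have := @maxG (hub_graph w) cardG outerH; rewrite /spread -lE.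
  by move: lH nH; rewrite nE; lra.
split=> //.
have degw : (degree w)%:R = s ^+ 2.
  have : #|nonneighbours w|%:R = 0 :> R.
    rewrite (_ : nonneighbours w = finset.set0) ?cards0 //.
    by apply/setP => v; rewrite !finset.in_set; apply/negP => /andP[/dom ->].
  by rewrite card_nonneighbours; lra.
have l2 : 2 < `|l| by lra.
have n2 : 2 < `|- n| by rewrite normrN; lra.
have El := eigenvalue_dominated outerG dom xP l2.
have En := eigenvalue_dominated outerG dom yP n2.
rewrite degw norml in El; rewrite degw normrN normn in En.
apply: (link_degree_estimate s1 _ _ _ ln El En); [lra|lra|].
by apply: sumr_ge0 => v _; exact: ler0n.
Qed.

End MaximalSpread.

Theorem theorem1p1 (R : realType) :
  exists (c : R) (N : nat), 0 < c /\
    forall (n : nat), (N <= n)%N ->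
    forall G : sgraph, #|G| = n -> outerplanar R G ->
      (forall H : sgraph, #|H| = n -> outerplanar R H ->
         spread R H <= spread R G) ->
      exists F : sgraph,
        [/\ linear_forest F, #|F| = (n - 1)%N,
            c * n%:R <= #|edges F|%:R & isomorphic G (join K1 F)].
Proof.
have [K KP] : exists K : nat, 1000 ^+ 2 < K%:R :> R.
  by exists (Num.truncn (1000 ^+ 2 : R)).+1; exact: truncnS_gt.
(* With [n] standing for one less than the number of vertices, [n <= 16 D] and [D] is at most twice
   the number of edges, which is thus at least [n / 32], hence at least [(n + 1) / 64]. The choice
   of [K] ensures [s >= 1000]. *)
exists 64^-1, K.+1; split; first by rewrite invr_gt0.
case=> // n Kn G cardG outerG maxG.
pose s : R := Num.sqrt n%:R.
have s2 : s ^+ 2 = n%:R by rewrite sqr_sqrtr.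
have s1 : 1000 <= s.
  have s0 : 0 <= s by exact: sqrtr_ge0.
  have Kn' : K%:R <= n%:R :> R by rewrite ler_nat.
  rewrite leNgt; apply/negP => sl; have : s * s <= 1000 * 1000 by apply: ler_pM => //; exact: ltW.
  by move: s2 KP Kn'; lra.
have [w [dom D]] := maximal_spread_structure outerG cardG maxG erefl s1 erefl erefl.
exists (delete_vertex w); split.
- exact: (delete_vertex_linear dom outerG).
- by rewrite card_delete_vertex cardG.
- have := sum_link_degree w; rewrite -(ler_nat R) natr_sum natrM => E.
  have n1 : 1 <= n%:R :> R.
    by have Kn' : K%:R <= n%:R :> R by [rewrite ler_nat]; move: KP Kn'; lra.
  by move: D; rewrite s2 -natr1; lra.
- exact: join_delete_vertex.
Qed.
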